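(* Let $K\in\mathbb{R}^{m\times n}$ be such that $KK^*\in\mathbb{R}^{m\times m}$ is diagonally dominant, let $J(u)=\|Ku\|_1$ on $\mathbb{R}^n$, and let $f\in\mathbb{R}^n$. Then the gradient flow, the variational method and the inverse scale space flow all yield the same spectral representation, i.e. $\phi_{GF}=\phi_{VM}=\phi_{IS}$ as distributions in $t>0$.
   Context: $\partial J$ is the convex subdifferential, $\|\cdot\|$ the Euclidean norm, $K^*$ the transpose of $K$. A matrix $A$ is diagonally dominant if $|A_{ll}|\ge\sum_{j\ne l}|A_{lj}|$ for every $l$. Gradient flow: $\partial_tu_{GF}(t)=-p_{GF}(t)$, $p_{GF}(t)\in\partial J(u_{GF}(t))$ for a.e. $t>0$, $u_{GF}(0)=f$. Variational method: $u_{VM}(t)=\arg\min_u\frac12\|u-f\|^2+tJ(u)$ for $t>0$. Inverse scale space flow: $\partial_sq_{IS}(s)=f-v_{IS}(s)$, $q_{IS}(s)\in\partial J(v_{IS}(s))$ for a.e. $s>0$, $q_{IS}(0)=0$. Spectral (wavelength) representations (distributional derivatives): $\phi_{VM}(t)=t\,\partial_{tt}u_{VM}(t)$, $\phi_{GF}(t)=t\,\partial_{tt}u_{GF}(t)$, and $\phi_{IS}$ is the image of the frequency representation $\tilde\phi_{IS}(s)=\partial_sv_{IS}(s)$ under the change of variables $t=1/s$, i.e. $\int_0^\infty\phi_{IS}(t)\cdot w(t)\,dt=\int_0^\infty\tilde\phi_{IS}(s)\cdot w(1/s)\,ds$ for test functions $w$; equivalently $\phi_{IS}=-\partial_tu_{IS}$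 with $u_{IS}(t)=v_{IS}(1/t)$. *)

(* Defs.v *)
From HB Require Import structures.
From mathcomp Require Import all_boot all_order all_algebra.
From mathcomp Require Import all_classical all_reals all_analysis.

Set Implicit Arguments.
Unset Strict Implicit.
Unset Printing Implicit Defensive.

Import Order.TTheory GRing.Theory Num.Theory.
Import numFieldNormedType.Exports.

Local Open Scope classical_set_scope.
Local Open Scope ring_scope.

Definition diag_dominant (R : realType) (m : nat) (A : 'M[R]_m) : Prop :=
  forall l, \sum_(j < m | j != l) `|A l j| <= `|A l l|.

(** The norm on matrices provided by the library is the sup norm, so the
    Euclidean structure on column vectors is introduced here. *)
Definition dotv (R : realType) (n : nat) (x y : 'cV[R]_n) : R :=
  \sum_(i < n) x i 0 * y i 0.

Definition enorm (R : realType) (n : nat) (x : 'cV[R]_n) : R :=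
  Num.sqrt (dotv x x).

Definition l1norm (R : realType) (m : nat) (y : 'cV[R]_m) : R :=
  \sum_(i < m) `|y i 0|.

Definition l1_analysis (R : realType) (m n : nat) (K : 'M[R]_(m, n))
    (u : 'cV[R]_n) : R := l1norm (K *m u).

Definition subdifferential (R : realType) (n : nat) (J : 'cV[R]_n -> R)
    (u : 'cV[R]_n) : set 'cV[R]_n :=
  [set p | forall v, J u + dotv p (v - u) <= J v].

(** Curves are total functions [R -> 'cV[R]_n]; only their values on [0, oo)
    (or on (0, oo)) matter.  Continuity, differentiability, etc. of a curve are
    understood coordinatewise. *)
Definition coordf (R : realType) (n : nat) (u : R -> 'cV[R]_n) (i : 'I_n) :
  R -> R := fun t => u t i 0.

Definition abs_continuous (R : realType) (a b : R) (g : R -> R) : Prop :=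
  forall e : R, 0 < e -> exists2 d : R, 0 < d &
    forall (N : nat) (x y : 'I_N -> R),
      (forall k, a <= x k /\ x k <= y k /\ y k <= b) ->
      trivIset setT (fun k => [set` `]x k, y k[]) ->
      \sum_(k < N) (y k - x k) < d ->
      \sum_(k < N) `|g (y k) - g (x k)| < e.

(** Strong solutions in the sense of Brezis: curves that are continuous on
    [0, oo) and absolutely continuous on compact subintervals of (0, oo). *)
Definition strong_curve (R : realType) (n : nat) (u : R -> 'cV[R]_n) : Prop :=
  forall i, {within `[0, +oo[, continuous (coordf u i)} /\
    forall a b : R, 0 < a -> a <= b -> abs_continuous a b (coordf u i).

Definition has_velocity (R : realType) (n : nat) (u : R -> 'cV[R]_n)
    (t : R) (d : 'cV[R]_n) : Prop :=
  forall i, is_derive t (1 : R) (coordf u i) (d i 0).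

Definition gradient_flow (R : realType) (n : nat) (J : 'cV[R]_n -> R)
    (f : 'cV[R]_n) (u p : R -> 'cV[R]_n) : Prop :=
  [/\ strong_curve u,
      u 0 = f &
      {ae lebesgue_measure, forall t : R, 0 < t ->
        has_velocity u t (- p t) /\ subdifferential J (u t) (p t)}].

Definition variational_method (R : realType) (n : nat) (J : 'cV[R]_n -> R)
    (f : 'cV[R]_n) (u : R -> 'cV[R]_n) : Prop :=
  forall t : R, 0 < t -> forall v : 'cV[R]_n,
    2^-1 * enorm (u t - f) ^+ 2 + t * J (u t) <=
    2^-1 * enorm (v - f) ^+ 2 + t * J v.

Definition inverse_scale_space_flow (R : realType) (n : nat)
    (J : 'cV[R]_n -> R) (f : 'cV[R]_n) (v q : R -> 'cV[R]_n) : Prop :=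
  [/\ strong_curve q,
      q 0 = 0,
      forall i, measurable_fun (`]0, +oo[ : set R) (coordf v i) &
      {ae lebesgue_measure, forall s : R, 0 < s ->
        has_velocity q s (f - v s) /\ subdifferential J (v s) (q s)}].

(** Smooth R^n-valued functions with compact support in (0, oo), extended by
    zero to the whole line. *)
Definition test_function (R : realType) (n : nat) (w : R -> 'cV[R]_n) : Prop :=
  (forall i k t, derivable (derive1n k (coordf w i)) t 1) /\
  exists a b : R, 0 < a /\ forall t, ~ (a <= t <= b) -> w t = 0.

(** R^n-valued distributions on (0, oo), as functionals of which only the values
    on test functions are meaningful; see [eq_distr]. *)
Definition distr (R : realType) (n : nat) : Type := (R -> 'cV[R]_n) -> R.

Definition eq_distr (R : realType) (n : nat) (S T : distr R n) : Prop :=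
  forall w, test_function w -> S w = T w.

Definition distr_of (R : realType) (n : nat) (u : R -> 'cV[R]_n) : distr R n :=
  fun w => \int[lebesgue_measure]_(t in `]0, +oo[) dotv (u t) (w t).

Definition curve_derive (R : realType) (n : nat) (w : R -> 'cV[R]_n) :
  R -> 'cV[R]_n := fun t => \col_i derive1 (coordf w i) t.

Definition distr_derive (R : realType) (n : nat) (T : distr R n) : distr R n :=
  fun w => - T (curve_derive w).

Definition distr_mulX (R : realType) (n : nat) (T : distr R n) : distr R n :=
  fun w => T (fun t => t *: w t).

(** Image under the change of variables [t = 1 / s]: the test function [w] in
    [t] becomes [s |-> w (1 / s)].  As [0^-1 = 0] and [w] vanishes near [0] and
    on the negative axis, the latter is again a test function. *)
Definition distr_inv_var (R : realType) (n : nat) (T : distr R n) : distr R n :=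
  fun w => T (fun s => w s^-1).

Definition phiVM (R : realType) (n : nat) (uVM : R -> 'cV[R]_n) : distr R n :=
  distr_mulX (distr_derive (distr_derive (distr_of uVM))).

Definition phiGF (R : realType) (n : nat) (uGF : R -> 'cV[R]_n) : distr R n :=
  distr_mulX (distr_derive (distr_derive (distr_of uGF))).

Definition phiIS_freq (R : realType) (n : nat) (vIS : R -> 'cV[R]_n) :
  distr R n := distr_derive (distr_of vIS).

Definition phiIS (R : realType) (n : nat) (vIS : R -> 'cV[R]_n) : distr R n :=
  distr_inv_var (phiIS_freq vIS).

(* Main.v *)
Require Import Defs.
From HB Require Import structures.
From mathcomp Require Import all_boot all_order all_algebra.
From mathcomp Require Import all_classical all_reals all_analysis.
From mathcomp Require Import measurable_realfun ring lra.

Set Implicit Arguments.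
Unset Strict Implicit.
Unset Printing Implicit Defensive.

Import Order.TTheory GRing.Theory Num.Theory.
Import numFieldNormedType.Exports.

Local Open Scope classical_set_scope.
Local Open Scope ring_scope.

(** Write [z t = K u(t)] for the gradient flow [u].  Diagonal dominance of
    [K K^T] makes every coordinate of [z] move towards zero, and a coordinate
    that has reached zero stays there; so coordinates never change sign, and the
    sign pattern of [z t] only loses entries
    ([gradient_flow_sign_dominated]).  As [J] is additive along vectors of
    compatible sign pattern, a subgradient of [J] at [u(s)] is still one at
    [u(t)] for [t >= s] ([subdifferential_sign_dominated]).  Averaging the
    negative velocities over [[0, t]] puts [(f - u(t)) / t] in the subdifferential at
    [u(t)] ([gradient_flow_subdifferential]), which is the optimality condition
    of the variational method; hence [uVM = uGF] on [t > 0], and the first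
    equality is immediate.

    For the inverse scale space flow put [y s = s u(1/s)], called [kelvin] below,
    and [Q s = s (f - u(1/s)) = s f - y s], called [dual_flow].  The increment
    [y s' - y s] with [s < s'] is [s' u(1/s') - s u(1/s)], whose image under [K]
    has no signs but those of [K u(1/s')].  Therefore [Q s'] is a subgradient at
    this increment: [Q] solves the implicit Euler scheme of the inverse scale
    space flow exactly, for every step size
    ([dual_flow_kelvin_increment]).  Comparing it with [q] by monotonicity of
    the subdifferential shows that [|q - Q|^2] is nonincreasing; it tends to zero
    at zero, so [q = Q] ([inverse_scale_space_dual_flow]).  Finite steps are
    used because an almost everywhere derivative of [u (1/s)] would require null
    sets to be carried along [s |-> 1/s].

    Consequently [v = f - q' = y'] almost everywhere.  For a test function [w]
    with [W s = w (1/s)], an integration by parts and the substitution [t = 1/s]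
    give
      [- int v W' = int y W'' = int u (t w)''],
    since [W'' s = s^-3 (t w)''(1/s)] ([kelvin_pairing]); the outer terms are the
    pairings of [w] with the two spectral representations.

    Solutions being only absolutely continuous, both comparison arguments and
    the integration by parts rest on one real-variable fact: an absolutely
    continuous function whose right upper derivative is almost everywhere
    nonpositive is nonincreasing ([abs_continuous_nonincreasing]). *)

(** * Absolutely continuous functions *)

Lemma abs_continuous_dominated (R : realType) (a b C : R) (g g1 g2 : R -> R) :
  0 < C ->
  (forall x y, a <= x -> x <= y -> y <= b ->
     `|g y - g x| <= C * (`|g1 y - g1 x| + `|g2 y - g2 x|)) ->
  abs_continuous a b g1 -> abs_continuous a b g2 -> abs_continuous a b g.
Proof.
move=> C0 le_g ac1 ac2 e e0.
have e'0 : 0 < e / (2 * C) by rewrite divr_gt0 ?mulr_gt0.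
have [d1 d10 h1] := ac1 _ e'0; have [d2 d20 h2] := ac2 _ e'0.
exists (Num.min d1 d2) => [|N x y xy tI]; first by rewrite lt_min d10.
rewrite lt_min => /andP[l1 l2].
apply: (@le_lt_trans _ _ (C * (\sum_(k < N) `|g1 (y k) - g1 (x k)| +
                               \sum_(k < N) `|g2 (y k) - g2 (x k)|))).
  rewrite -big_split mulr_sumr; apply: ler_sum => k _.
  by have [? [? ?]] := xy k; exact: le_g.
have := h1 N x y xy tI l1; have := h2 N x y xy tI l2.
rewrite -ltr_pdivlMl// => s2 s1.
have -> : C^-1 * e = e / (2 * C) + e / (2 * C).
  by rewrite -mulrDr -div1r; field; rewrite gt_eqF.
exact: ltrD.
Qed.

Lemma abs_continuous_lipschitz (R : realType) (a b C : R) (g : R -> R) :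
  0 < C ->
  (forall x y, a <= x -> x <= y -> y <= b -> `|g y - g x| <= C * (y - x)) ->
  abs_continuous a b g.
Proof.
move=> C0 lipg e e0; exists (e / C); first by rewrite divr_gt0.
move=> N x y xy _; rewrite ltr_pdivlMr// mulrC; apply: le_lt_trans.
rewrite mulr_sumr; apply: ler_sum => k _.
by have [? [? ?]] := xy k; exact: lipg.
Qed.

Lemma abs_continuous_unif (R : realType) (a b : R) (g : R -> R) :
  abs_continuous a b g -> forall e, 0 < e -> exists2 d, 0 < d &
  forall x y, a <= x -> x <= y -> y <= b -> y - x < d -> `|g y - g x| < e.
Proof.
move=> acg e e0; have [d d0 h] := acg e e0; exists d => // x y ax xy yb dxy.
have := h 1%N (fun=> x) (fun=> y); rewrite !big_ord1; apply => //.
by move=> i j _ _ _; rewrite (ord1 i) (ord1 j).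
Qed.

(** Uniform continuity at scale [d] bounds [|g x|] by [|g a|] plus the number
    of steps of length [d / 2] from [a] to [x]. *)
Lemma abs_continuous_bounded (R : realType) (a b : R) (g : R -> R) :
  abs_continuous a b g ->
  exists2 M, 0 < M & forall x, a <= x <= b -> `|g x| <= M.
Proof.
move=> acg; have [d d0 h] := abs_continuous_unif acg ltr01.
have bd k x : a <= x <= b -> x - a <= k%:R * (d / 2) -> `|g x| <= `|g a| + k%:R.
  elim: k x => [|k IH] x /andP[ax xb].
    rewrite mul0r subr_le0 => xa.
    by have -> : x = a; [apply/eqP; rewrite eq_le xa|rewrite addr0].
  move=> xk; pose x' := Num.max a (x - d / 2).
  have ax' : a <= x' by rewrite le_max lexx.
  have x'x : x' <= x by rewrite ge_max ax /= gerBl; lra.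
  have /(IH x') : a <= x' <= b by rewrite ax' (le_trans x'x).
  have x'k : x' - a <= k%:R * (d / 2).
    rewrite lerBlDr ge_max -subr_ge0 addrK mulr_ge0//= ?divr_ge0 ?(ltW d0)//.
    by move: xk; rewrite -natr1; lra.
  move=> /(_ x'k) gx'.
  have /ltW : `|g x - g x'| < 1.
    apply: h => //; apply: (@le_lt_trans _ _ (d / 2)); last by lra.
    by rewrite lerBlDr -lerBlDl le_max lexx orbT.
  move: (ler_normD (g x - g x') (g x')); rewrite subrK -natr1; lra.
exists (`|g a| + (Num.trunc ((b - a) / (d / 2))).+1%:R).
  by rewrite ltr_wpDl.
move=> x axb; apply: bd => //; rewrite -ler_pdivrMr; last by rewrite divr_gt0.
apply: le_trans (ltW (truncnS_gt _)); rewrite ler_pM2r ?invr_gt0 ?divr_gt0//.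
by move: axb => /andP[]; lra.
Qed.

Lemma abs_continuousM (R : realType) (a b : R) (g1 g2 : R -> R) :
  abs_continuous a b g1 -> abs_continuous a b g2 ->
  abs_continuous a b (fun x => g1 x * g2 x).
Proof.
move=> ac1 ac2.
have [M1 M10 b1] := abs_continuous_bounded ac1.
have [M2 M20 b2] := abs_continuous_bounded ac2.
apply: (abs_continuous_dominated (C := M1 + M2) _ _ ac1 ac2) => [|x y ax xy yb].
  exact: addr_gt0.
have -> : g1 y * g2 y - g1 x * g2 x = g1 y * (g2 y - g2 x) + g2 x * (g1 y - g1 x).
  by ring.
apply: (le_trans (ler_normD _ _)); rewrite !normrM mulrDr addrC lerD//.
  rewrite ler_wpM2r// (le_trans (b2 x _)) ?ax ?(le_trans xy)// lerDr; exact: ltW.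
rewrite ler_wpM2r// (le_trans (b1 y _)) ?yb ?(le_trans ax)// lerDl; exact: ltW.
Qed.

Lemma abs_continuousD (R : realType) (a b : R) (g1 g2 : R -> R) :
  abs_continuous a b g1 -> abs_continuous a b g2 ->
  abs_continuous a b (fun x => g1 x + g2 x).
Proof.
move=> ac1 ac2.
apply: (abs_continuous_dominated (C := 1) _ _ ac1 ac2) => // x y _ _ _.
by rewrite mul1r opprD addrACA ler_normD.
Qed.

Lemma abs_continuous_cst (R : realType) (a b c : R) :
  abs_continuous a b (fun=> c).
Proof.
apply: (@abs_continuous_lipschitz _ _ _ 1) => // x y _ xy _.
by rewrite subrr normr0 mul1r subr_ge0.
Qed.

Lemma abs_continuous_sum (R : realType) (a b : R) (n : nat)
    (g : 'I_n -> R -> R) :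
  (forall i, abs_continuous a b (g i)) ->
  abs_continuous a b (fun x => \sum_(i < n) g i x).
Proof.
move=> acg; elim: (index_enum _) => [|i s IH].
  by rewrite (eq_fun (fun x => big_nil _ _ _ _)); exact: abs_continuous_cst.
by rewrite (eq_fun (fun x => big_cons _ _ _ _ _ _)); exact: abs_continuousD.
Qed.

Lemma abs_continuousB (R : realType) (a b : R) (g1 g2 : R -> R) :
  abs_continuous a b g1 -> abs_continuous a b g2 ->
  abs_continuous a b (fun x => g1 x - g2 x).
Proof.
move=> ac1 ac2.
apply: (abs_continuous_dominated (C := 1) _ _ ac1 ac2) => // x y _ _ _.
rewrite mul1r opprB [X in X <= _](_ : _ = `|(g1 y - g1 x) - (g2 y - g2 x)|).
  exact: ler_normB.
by congr `|_|; ring.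
Qed.

(** Links the absolute continuity modulus, which bounds the total length of a
    finite family, with the measure of an open set that covers an exceptional
    null set. *)
Lemma sum_itv_lengths_le (R : realType) (N : nat) (x y : 'I_N -> R) (U : set R)
    (d : R) :
  measurable U -> (forall k, x k <= y k) ->
  (forall k, `]x k, y k[ `<=` U) ->
  trivIset setT (fun k => [set` `]x k, y k[]) ->
  (lebesgue_measure U <= d%:E)%E -> \sum_(k < N) (y k - x k) <= d.
Proof.
move=> mU xy subU tI; rewrite -lee_fin; apply: le_trans.
have -> : ((\sum_(k < N) (y k - x k))%:E =
           lebesgue_measure (\big[setU/set0]_(k < N) [set` `]x k, y k[]))%E.
  rewrite measure_bigsetU_ord// -sumEFin; apply: eq_bigr => k _.
  apply/esym/(etrans (lebesgue_measure_itv _)); rewrite /= lte_fin.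
  case: ltP => // yx.
  by have -> : y k = x k; [apply/eqP; rewrite eq_le yx xy|rewrite subrr].
apply: le_measure; rewrite ?inE//.
  by apply: bigsetU_measurable => k _.
by apply: (big_ind (fun A => A `<=` U)) => // A B AU BU t [/AU|/BU].
Qed.

(** * Monotonicity from one-sided derivatives almost everywhere *)

Lemma negligible_open_cover (R : realType) (N : set R) (e : R) : 0 < e ->
  lebesgue_measure.-negligible N ->
  exists U, [/\ open U, N `<=` U & (lebesgue_measure U <= e%:E)%E].
Proof.
move=> e0 /negligible_outer_measure N0.
by have := @outer_measure_open_le R N e e0; rewrite N0 add0e.
Qed.

(** Prolongs a competitor for the supremum in the next proof; [ord_max] indexes
    the new interval. *)
Lemma trivIset_itv_rcons (R : realType) (N : nat) (x y : 'I_N -> R) (c c' : R) :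
  (forall k, y k <= c) -> trivIset setT (fun k => [set` `]x k, y k[]) ->
  trivIset setT (fun k : 'I_N.+1 =>
    [set` `](oapp x c (unlift ord_max k)), (oapp y c' (unlift ord_max k))[]).
Proof.
move=> yc tI i j _ _ [z []].
case: unliftP => [i'|] ->; case: unliftP => [j'|] -> //=; rewrite !in_itv/=.
- move=> zi zj; congr lift; apply: tI => //.
  by exists z; split; rewrite /= in_itv.
- by move=> /andP[_ zy] /andP[cz _]; have := lt_trans cz (lt_le_trans zy (yc _)); rewrite ltxx.
- by move=> /andP[cz _] /andP[_ zy]; have := lt_trans cz (lt_le_trans zy (yc _)); rewrite ltxx.
Qed.

(** Cover the exceptional null set by an open [U] so small that disjoint
    intervals inside [U] carry total variation of [g] at most [e]. Let [B x] be
    the supremum of such variations left of [x]. The set of [x] with [g x <= g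
    a + e * (x - a) + B x] is closed under limits from the left, because [g] is
    continuous and [B] monotone, and can be prolonged to the right of each of
    its points: by the derivative bound outside the exceptional set, and inside
    [U] because [B] absorbs the variation of [g] over a short interval. Hence
    it contains [b], where [B b <= e]. *)
Lemma abs_continuous_nonincreasing (R : realType) (a b : R) (g : R -> R) :
  a <= b -> abs_continuous a b g ->
  {ae lebesgue_measure, forall x : R, a <= x < b -> forall e : R, 0 < e ->
     exists2 d : R, 0 < d & forall h : R, 0 < h -> h < d -> g (x + h) <= g x + e * h} ->
  g b <= g a.
Proof.
move=> ab acg aeg.
(* a bound for every [e] is enough: an increase of [g] over [[a, b]] is
   contradicted by a small multiple of it *)
suff le_e (e : R) : 0 < e -> g b <= g a + e * (b - a) + e.
  rewrite leNgt; apply/negP => gab.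
  have := le_e ((g b - g a) / (2 * (b - a + 1))).
  have -> : g a + (g b - g a) / (2 * (b - a + 1)) * (b - a) +
            (g b - g a) / (2 * (b - a + 1)) = g a + (g b - g a) / 2.
    by field; rewrite gt_eqF//; lra.
  rewrite divr_gt0; [|lra|lra].
  by move=> /(_ isT); lra.
move=> e0; have [d d0 acd] := acg e e0.
have d20 : 0 < d / 2 by rewrite divr_gt0.
have [U [oU NU muU]] := negligible_open_cover d20 aeg.
pose T (x : R) : set R := [set s | exists N (p q : 'I_N -> R),
  [/\ forall k, a <= p k /\ p k <= q k /\ q k <= x,
      forall k, `]p k, q k[ `<=` U,
      trivIset setT (fun k => [set` `]p k, q k[]) &
      s = \sum_(k < N) `|g (q k) - g (p k)|]].
have T0 x : T x 0.
  by exists 0%N, (fun=> 0), (fun=> 0); split => //; [case|case|case|rewrite big_ord0].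
have ubT x s : x <= b -> T x s -> s <= e.
  move=> xb [N [p [q [pq pqU tI ->]]]]; apply/ltW/acd => //.
    by move=> k; have [? [? ?]] := pq k; do 2 split => //; exact: le_trans xb.
  apply: (@le_lt_trans _ _ (d / 2)); last by lra.
  apply: (@sum_itv_lengths_le _ _ p q U) => //; first exact: open_measurable.
  by move=> k; have [? []] := pq k.
have hsT x : x <= b -> has_sup (T x).
  by move=> xb; split; [exists 0|exists e => s; exact: ubT].
pose B x := sup (T x).
have TB x s : x <= b -> T x s -> s <= B x.
  by move=> xb; apply: ub_le_sup; have [] := hsT x xb.
have B0 x : x <= b -> 0 <= B x by move=> /TB; exact.
have Bmono x y : x <= y -> y <= b -> B x <= B y.
  move=> xy yb; apply: ge_sup; first by exists 0.
  move=> s [N [p [q [pq pqU tI ->]]]]; apply: TB => //.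
  exists N, p, q; split => // k; have [? [? qx]] := pq k.
  by do 2 split => //; exact: le_trans xy.
pose S := [set x | a <= x <= b /\ g x <= g a + e * (x - a) + B x].
have Sa : S a.
  by split; rewrite ?lexx ?ab// subrr mulr0 addr0 lerDl B0.
have hS : has_sup S by split; [exists a|exists b => x [/andP[]]].
pose c := sup S.
have ac : a <= c by apply: ub_le_sup => //; have [] := hS.
have cb : c <= b by apply: ge_sup; [exists a|move=> x [/andP[]]].
have Sc : S c.
  split; first by rewrite ac.
  apply/ler_addgt0Pr => r r0.
  have [d' d'0 unifg] := abs_continuous_unif acg r0.
  have [x [/andP[ax xb] gx] cx] := sup_adherent d'0 hS.
  have xc : x <= c by apply: ub_le_sup => //; [have [] := hS|split => //; rewrite ax].
  have : `|g c - g x| < r by apply: unifg => //; rewrite -/c in cx; lra.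
  have : e * (x - a) <= e * (c - a) by rewrite ler_pM2l//; lra.
  have := Bmono x c xc cb.
  rewrite ltr_norml => ? ? /andP[]; lra.
(* as [c] is the supremum, no point right of it satisfies the bound *)
have ext (h : R) : 0 < h -> c + h <= b ->
    g (c + h) <= g a + e * (c + h - a) + B (c + h) -> False.
  move=> h0 hb gh; have : c + h <= c; last by lra.
  by apply: ub_le_sup; [have [] := hS|split => //; rewrite hb andbT; lra].
have [cltb|bc] := ltP c b; last first.
  have cEb : c = b by apply/eqP; rewrite eq_le cb.
  case: Sc => _; rewrite cEb => gc.
  have : B b <= e by apply: ge_sup; [exists 0|move=> s; exact: ubT].
  by move: gc; lra.
exfalso.
have [good|bad] := pselect (forall e : R, 0 < e -> exists2 d : R, 0 < d &
     forall h : R, 0 < h -> h < d -> g (c + h) <= g c + e * h).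
  have [d' d'0 hd'] := good e e0.
  pose h := Num.min (d' / 2) (b - c).
  have h0 : 0 < h by rewrite lt_min divr_gt0//= subr_gt0.
  have hb : c + h <= b by rewrite -lerBrDl ge_min lexx orbT.
  apply: (ext h) => //.
  have hlt : h < d' by rewrite gt_min; apply/orP; left; lra.
  have := hd' h h0 hlt.
  have : B c <= B (c + h) by apply: Bmono; rewrite // lerDl ltW.
  by case: Sc => _; lra.
have Uc : U c.
  by apply: NU => /= H; apply: bad; apply: H; rewrite ac.
have [r r0 rU] : exists2 r, 0 < r & ball c r `<=` U.
  have /nbhs_ballP[r r0 rU] : nbhs c U by exact: open_nbhs_nbhs.
  by exists r.
pose h := Num.min (r / 2) (b - c).
have h0 : 0 < h by rewrite lt_min divr_gt0//= subr_gt0.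
have hb : c + h <= b by rewrite -lerBrDl ge_min lexx orbT.
apply: (ext h) => //.
suff : B c <= B (c + h) - `|g (c + h) - g c|.
  have := ler_norm (g (c + h) - g c); have : 0 < e * h by exact: mulr_gt0.
  by case: Sc => _; lra.
apply: ge_sup; first by exists 0.
move=> s [N [p [q [pq pqU tI ->]]]]; rewrite lerBrDr; apply: TB => //.
exists N.+1, (fun k => oapp p c (unlift ord_max k)),
  (fun k => oapp q (c + h) (unlift ord_max k)); split.
- move=> k; case: unliftP => [k'|] _ /=.
    by have [? [? ?]] := pq k'; do 2 split => //; lra.
  by do 2 split => //; lra.
- move=> k; case: unliftP => [k'|] _ /=; first exact: pqU.
  move=> t; rewrite /= in_itv/= => /andP[ct th]; apply: rU.
  have : h <= r / 2 by rewrite ge_min lexx.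
  by rewrite /ball/= ltr_norml => hr; apply/andP; split; lra.
- by apply: trivIset_itv_rcons => // k; have [? []] := pq k.
- rewrite big_ord_recr/= unlift_none/=; congr (_ + _).
  apply: eq_bigr => k _.
  have -> : widen_ord (leqnSn N) k = lift ord_max k.
    by apply: val_inj => /=; rewrite /bump leqNgt ltn_ord.
  by rewrite liftK.
Qed.

(** * The functional and its subdifferential *)

Section dotv_theory.
Context (R : realType) (n : nat).
Implicit Types x y z : 'cV[R]_n.

Lemma dotvC x y : dotv x y = dotv y x.
Proof. by apply: eq_bigr => i _; rewrite mulrC. Qed.

Lemma dotvDr x y z : dotv x (y + z) = dotv x y + dotv x z.
Proof. by rewrite -big_split; apply: eq_bigr => i _; rewrite mxE mulrDr. Qed.

Lemma dotvZr c x y : dotv x (c *: y) = c * dotv x y.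
Proof. by rewrite mulr_sumr; apply: eq_bigr => i _; rewrite mxE mulrCA. Qed.

Lemma dotvNr x y : dotv x (- y) = - dotv x y.
Proof. by rewrite -scaleN1r dotvZr mulN1r. Qed.

Lemma dotvDl x y z : dotv (x + y) z = dotv x z + dotv y z.
Proof. by rewrite dotvC dotvDr !(dotvC z). Qed.

Lemma dotvZl c x y : dotv (c *: x) y = c * dotv x y.
Proof. by rewrite dotvC dotvZr dotvC. Qed.

Lemma dotvNl x y : dotv (- x) y = - dotv x y.
Proof. by rewrite dotvC dotvNr dotvC. Qed.

Lemma dotv0r x : dotv x 0 = 0.
Proof. by rewrite -(scale0r 0) dotvZr mul0r. Qed.

Definition dotvE := (dotvDr, dotvDl, dotvNr, dotvNl, dotvZr, dotvZl).

Lemma dotv_ge0 x : 0 <= dotv x x.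
Proof. by apply: sumr_ge0 => i _; rewrite -expr2 sqr_ge0. Qed.

Lemma dotv_le0_eq0 x : dotv x x <= 0 -> x = 0.
Proof.
move=> x0; have /eqP : dotv x x = 0 by apply/eqP; rewrite eq_le x0 dotv_ge0.
rewrite psumr_eq0 => [/allP x0'|i _]; last by rewrite -expr2 sqr_ge0.
apply/colP => i; rewrite mxE; apply/eqP.
by have := x0' i (mem_index_enum i); rewrite /= mulf_eq0 orbb.
Qed.

Lemma dotv_delta x i : dotv x (delta_mx i 0) = x i 0.
Proof.
rewrite /dotv (bigD1 i)//= mxE !eqxx mulr1 big1 ?addr0// => j ji.
by rewrite mxE (negbTE ji) mulr0.
Qed.

Lemma enorm_sqr x : enorm x ^+ 2 = dotv x x.
Proof. by rewrite sqr_sqrtr// dotv_ge0. Qed.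

End dotv_theory.

Lemma dotv_trmx (R : realType) (m n : nat) (K : 'M[R]_(m, n)) x y :
  dotv x (K^T *m y) = dotv (K *m x) y.
Proof.
have dotvEmx k (a b : 'cV[R]_k) : dotv a b = (a^T *m b) 0 0.
  by rewrite mxE; apply: eq_bigr => i _; rewrite mxE.
by rewrite !dotvEmx trmx_mul mulmxA.
Qed.

Section l1_analysis_theory.
Context (R : realType) (m n : nat) (K : 'M[R]_(m, n)).
Implicit Types u v w p : 'cV[R]_n.
Notation J := (l1_analysis K).

Lemma l1_analysisZ c u : J (c *: u) = `|c| * J u.
Proof.
rewrite /l1_analysis -scalemxAr /l1norm mulr_sumr.
by apply: eq_bigr => l _; rewrite mxE normrM.
Qed.

Lemma l1_analysis_ge0 u : 0 <= J u.
Proof. exact: sumr_ge0. Qed.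

(** For a positively homogeneous functional, test the subgradient inequality at
    [2 u] and at [0]. *)
Lemma subdifferential_l1P u p :
  subdifferential J u p <-> dotv p u = J u /\ forall v, dotv p v <= J v.
Proof.
split=> [pu|[pu le_p] v]; last by rewrite -pu dotvE dotvNr subrKC.
have pu2 := pu (2 *: u); have pu0 := pu (0 *: u).
move: pu2 pu0; rewrite !l1_analysisZ !dotvE normr0 !mul0r ger0_norm// => pu2 pu0.
have puE : dotv p u = J u by lra.
by split=> // v; have := pu v; rewrite !dotvE puE; lra.
Qed.

(** [y] vanishes wherever [x] does, and nowhere has the sign opposite to [x].
    *)
Definition sign_dominated (y x : 'cV[R]_m) : Prop :=
  forall l, 0 <= x l 0 * y l 0 /\ (x l 0 = 0 -> y l 0 = 0).

Lemma sign_dominated_scale x y : sign_dominated y x ->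
  exists2 t : R, 0 < t & forall l, t * `|y l 0| <= `|x l 0|.
Proof.
move=> yx.
pose s l := if x l 0 == 0 then 1 else `|x l 0| / (`|y l 0| + 1).
exists (\big[Num.min/1]_l s l).
  apply: lt_bigmin => [|l _]; [exact: ltr01|]; rewrite /s; case: eqVneq => // xl.
  by rewrite divr_gt0 ?normr_gt0// ltr_wpDl.
move=> l; have [xl|xl] := eqVneq (x l 0) 0.
  by rewrite (yx l).2// xl normr0 mulr0.
apply: (@le_trans _ _ (s l * `|y l 0|)).
  by rewrite ler_wpM2r// bigmin_le_cond.
rewrite /s (negbTE xl) mulrAC ler_pdivrMr ?ltr_wpDl//.
by rewrite ler_wpM2l// lerDl.
Qed.

(** [J] is affine on a short segment from [u] in the direction [- w], where no
    coordinate of [K u] changes sign; the subgradient inequality there yields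
    [J w <= dotv p w]. *)
Lemma subdifferential_sign_dominated u w p :
  subdifferential J u p -> sign_dominated (K *m w) (K *m u) ->
  dotv p w = J w.
Proof.
move=> /subdifferential_l1P[puE le_p] wu.
have [t t0 small] := sign_dominated_scale wu.
have JB : J (u - t *: w) = J u - t * J w.
  rewrite /l1_analysis /l1norm mulr_sumr -sumrB; apply: eq_bigr => l _.
  have -> : (K *m (u - t *: w)) l 0 = (K *m u) l 0 - t * (K *m w) l 0.
    by rewrite mulmxBr -scalemxAr !mxE.
  have := small l; have := wu l.
  set a := (K *m u) l 0; set b := (K *m w) l 0.
  have [a0|a0] := ger0P a; have [b0|b0] := ger0P b => -[ab ab0] tb.
  - by rewrite ger0_norm ?subr_ge0.
  - have a00 : a = 0 by apply/eqP; rewrite eq_le a0 -(ler_nM2r b0) mul0r ab.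
    by have := ab0 a00; lra.
  - have b00 : b = 0 by apply/eqP; rewrite eq_le b0 -(ler_nM2l a0) mulr0 ab.
    by rewrite b00 mulr0 !subr0 ltr0_norm.
  - by rewrite ler0_norm; [ring|move: tb; rewrite mulrN; lra].
have := le_p (u - t *: w); rewrite JB !dotvE puE => le1.
apply/eqP; rewrite eq_le le_p/= -(ler_pM2l t0); lra.
Qed.

(** Along [- p] no coordinate of [K u] moves away from zero. Test the
    subgradient inequality at [u - t * s *: K^T e_l], with [s] the sign of [(K
    u)_l] and [t] small: the [l]-th term of [J] drops by [t] times the diagonal
    entry of [K K^T] while the others grow by at most [t] times the
    off-diagonal row sum, so [J] does not increase. *)
Lemma subdifferential_diag_dominant u p l :
  diag_dominant (K *m K^T) -> subdifferential J u p ->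
  0 <= (K *m u) l 0 * (K *m p) l 0.
Proof.
move=> dd /subdifferential_l1P[puE le_p]; set A := K *m K^T in dd.
have [->|z0] := eqVneq ((K *m u) l 0) 0; first by rewrite mul0r.
set z := K *m u in z0 *.
have Asym i j : A i j = A j i.
  have AT : A^T = A by rewrite trmx_mul trmxK.
  by rewrite -{1}AT mxE.
have All0 : 0 <= A l l.
  by rewrite mxE; apply: sumr_ge0 => j _; rewrite mxE -expr2 sqr_ge0.
have [t t0 tA] : exists2 t : R, 0 < t & t * A l l <= `|z l 0|.
  exists (`|z l 0| / (A l l + 1)); first by rewrite divr_gt0 ?normr_gt0// ltr_wpDl.
  by rewrite mulrAC ler_pdivrMr ?ltr_wpDl// ler_wpM2l// lerDl.
pose s := Num.sg (z l 0).
pose v := u - (t * s) *: (K^T *m delta_mx l 0).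
have vE j : (K *m v) j 0 = z j 0 - t * s * A j l.
  rewrite mulmxBr -scalemxAr mulmxA -/A -colE -/z.
  have -> (a b : 'cV[R]_m) c : (a - c *: b) j 0 = a j 0 - c * b j 0.
    by rewrite !mxE.
  by congr (_ - _ * _); rewrite [LHS]mxE.
have Jv : J v <= J u.
  rewrite /l1_analysis /l1norm (bigD1 l)//= [leRHS](bigD1 l)//= !vE -/z.
  have -> : `|z l 0 - t * s * A l l| = `|z l 0| - t * A l l.
    rewrite {1}[z l 0]numEsg -/s.
    have -> : s * `|z l 0| - t * s * A l l = s * (`|z l 0| - t * A l l) by ring.
    by rewrite normrM normr_sg z0 mul1r ger0_norm ?subr_ge0.
  have : \sum_(j < m | j != l) `|(K *m v) j 0| <=
         \sum_(j < m | j != l) `|z j 0| + t * \sum_(j < m | j != l) `|A l j|.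
    rewrite mulr_sumr -big_split; apply: ler_sum => j jl; rewrite vE.
    apply: (le_trans (ler_normB _ _)); rewrite lerD2l !normrM normr_sg z0 mulr1.
    by rewrite (gtr0_norm t0) Asym.
  have := dd l; rewrite (ger0_norm All0) -(ler_pM2l t0).
  lra.
have := le_p v; rewrite !dotvE dotv_trmx dotv_delta puE => le1.
have : 0 <= t * s * (K *m p) l 0 by lra.
rewrite -mulrA pmulr_rge0// => sK.
by rewrite (numEsg (z l 0)) -/s mulrAC mulrC mulr_ge0.
Qed.

(** Optimality of [u] and strong convexity of the quadratic term: [u] is the
    only minimizer. *)
Lemma variational_minimizer_unique (f u w : 'cV[R]_n) (t : R) : 0 < t ->
  subdifferential J u (t^-1 *: (f - u)) ->
  2^-1 * enorm (w - f) ^+ 2 + t * J w <= 2^-1 * enorm (u - f) ^+ 2 + t * J u ->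
  w = u.
Proof.
move=> t0 /(_ w) Ju; rewrite !enorm_sqr => wu.
apply/eqP; rewrite -subr_eq0; apply/eqP/dotv_le0_eq0.
move: Ju; rewrite dotvZl -(ler_pM2l t0) mulrDr mulrA mulfV ?gt_eqF// mul1r.
move: wu; rewrite !dotvE (dotvC w f) (dotvC u f) (dotvC w u); lra.
Qed.

End l1_analysis_theory.

(** * The gradient flow *)

Lemma is_derive_increment (R : realType) (g : R -> R) (x d e : R) :
  is_derive x 1 g d -> 0 < e ->
  exists2 r : R, 0 < r &
    forall h : R, 0 < h -> h < r -> `|g (x + h) - g x - h * d| <= e * h.
Proof.
move=> gd e0.
have : h^-1 *: (g (h *: 1 + x) - g x) @[h --> 0^'] --> d.
  by have /= [dg <-] := gd; exact: dg.
move=> /cvgrPdist_le /(_ e e0); rewrite near_withinE.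
move=> /nbhs_ballP[r r0 hr]; exists r => // h h0 hlt.
have := hr h; rewrite /ball/= sub0r normrN (gtr0_norm h0).
move=> /(_ hlt); rewrite gt_eqF// => /(_ isT).
rewrite scaler1 (addrC h x) -(ler_pM2r h0); apply: le_trans.
have -> : g (x + h) - g x - h * d = - ((d - h^-1 * (g (x + h) - g x)) * h).
  by field; rewrite gt_eqF.
by rewrite normrN normrM (gtr0_norm h0).
Qed.

Lemma is_derive_le0_increment (R : realType) (g : R -> R) (x d : R) :
  is_derive x 1 g d -> d <= 0 -> forall e : R, 0 < e ->
  exists2 r : R, 0 < r & forall h : R, 0 < h -> h < r -> g (x + h) <= g x + e * h.
Proof.
move=> gd d0 e e0; have [r r0 hr] := is_derive_increment gd e0.
exists r => // h h0 hlt; have := hr h h0 hlt.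
have : h * d <= 0 by rewrite pmulr_rle0.
by rewrite ler_norml => ? /andP[]; lra.
Qed.

Lemma abs_continuous_within (R : realType) (a b : R) (g : R -> R) :
  abs_continuous a b g -> {within `[a, b], continuous g}.
Proof.
move=> acg; apply/subspace_continuousP => x; rewrite /= in_itv/= => /andP[ax xb].
apply/cvgrPdist_lt => e e0; rewrite near_withinE.
have [d d0 hd] := abs_continuous_unif acg e0.
apply/nbhs_ballP; exists d => // y; rewrite /ball/= in_itv/= => xy /andP[ay yb].
have [le_xy|/ltW le_yx] := leP x y.
  by rewrite distrC; apply: hd => //; move: xy; rewrite ltr_norml => /andP[]; lra.
by apply: hd => //; move: xy; rewrite ltr_norml => /andP[]; lra.
Qed.

Lemma is_derive_dotv (R : realType) (n : nat) (u : R -> 'cV[R]_n) t d w :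
  has_velocity u t d -> is_derive t (1 : R) (fun s => dotv (u s) w) (dotv d w).
Proof.
move=> ud.
have -> : (fun s => dotv (u s) w) = \sum_(i < n) (fun s => coordf u i s * w i 0).
  by rewrite fct_sumE.
apply: is_derive_sum => i.
have := @is_deriveM _ _ _ _ _ _ _ _ (ud i) (is_derive_cst (w i 0) t (1 : R)).
by move/is_derive_eq; apply; rewrite scaler0 add0r /= mulrC.
Qed.

Lemma abs_continuous_dotv (R : realType) (n : nat) (u : R -> 'cV[R]_n) a b w :
  (forall i, abs_continuous a b (coordf u i)) ->
  abs_continuous a b (fun s => dotv (u s) w).
Proof.
move=> acu; apply: abs_continuous_sum => i.
by apply: abs_continuousM; [exact: acu|exact: abs_continuous_cst].
Qed.

Lemma cvg_dotv (R : realType) (n : nat) (F : set_system R) (u v : R -> 'cV[R]_n)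
    (x y : 'cV[R]_n) : Filter F ->
  (forall i, coordf u i s @[s --> F] --> x i 0) ->
  (forall i, coordf v i s @[s --> F] --> y i 0) ->
  dotv (u s) (v s) @[s --> F] --> dotv x y.
Proof.
move=> FF ux vy; rewrite /dotv; elim: (index_enum _) => [|i s IH].
  rewrite big_nil (eq_fun (fun x => big_nil _ _ _ _)); exact: cvg_cst.
rewrite big_cons (eq_fun (fun x => big_cons _ _ _ _ _ _)).
by apply: cvgD => //; apply: cvgM; [exact: ux|exact: vy].
Qed.

Lemma strong_curve_right0 (R : realType) (n : nat) (u : R -> 'cV[R]_n) i :
  strong_curve u -> coordf u i s @[s --> 0^'+] --> u 0 i 0.
Proof. by move=> /(_ i)[/continuous_within_itvcyP[]]. Qed.

Section gradient_flow_theory.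
Context (R : realType) (m n : nat) (K : 'M[R]_(m, n)) (f : 'cV[R]_n).
Context (u p : R -> 'cV[R]_n).
Hypothesis hK : diag_dominant (K *m K^T).
Hypothesis hu : gradient_flow (l1_analysis K) f u p.
Notation J := (l1_analysis K).
Notation z l t := ((K *m u t) l 0).

Let cu : strong_curve u. Proof. by case: hu. Qed.

Let acu a b w : 0 < a -> a <= b -> abs_continuous a b (fun s => dotv (u s) w).
Proof. by move=> a0 ab; apply: abs_continuous_dotv => i; exact: (cu i).2. Qed.

Let zE l t : z l t = dotv (u t) (K^T *m delta_mx l 0).
Proof. by rewrite dotv_trmx dotv_delta. Qed.

Lemma gradient_flow_sqr_nonincreasing l s t : 0 < s -> s <= t ->
  z l t ^+ 2 <= z l s ^+ 2.
Proof.
move=> s0 st; rewrite !expr2 !zE; set c := K^T *m _.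
apply: (@abs_continuous_nonincreasing _ s t
  (fun x => dotv (u x) c * dotv (u x) c)) => //.
  by apply: abs_continuousM; exact: acu.
case: hu => _ _; apply: filterS; first exact: (ae_filter_ringOfSetsType lebesgue_measure).
move=> x hx /andP[sx _]; have [ux px] := hx (lt_le_trans s0 sx).
have dx := is_derive_dotv c ux.
apply: (is_derive_le0_increment (is_deriveM dx dx)).
have := subdifferential_diag_dominant l hK px.
have -> : (K *m p x) l 0 = dotv (p x) c by rewrite dotv_trmx dotv_delta.
by rewrite zE -/c dotvNl /= => ?; rewrite /GRing.scale/=; lra.
Qed.

(** A change of sign would force a zero in between, after which the coordinate
    vanishes. *)
Lemma gradient_flow_sign l s t : 0 < s -> s <= t -> 0 <= z l s * z l t.
Proof.
move=> s0 st; rewrite leNgt; apply/negP => neg.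
have [] := @IVT _ (fun x => z l x) s t 0 st.
- rewrite (eq_fun (zE l)); exact/abs_continuous_within/acu.
- rewrite ge_min le_max.
  have [zs|zs] := ltP (z l s) 0; have [zt|zt] := ltP (z l t) 0.
  + by move: neg; rewrite nmulr_rlt0// ltNge (ltW zt).
  + by rewrite (ltW zs) ?zt orbT.
  + by rewrite (ltW zt) ?zs orbT.
  + by move: neg; rewrite ltNge mulr_ge0.
move=> c; rewrite in_itv/= => /andP[sc ct] zc.
have := gradient_flow_sqr_nonincreasing l (lt_le_trans s0 sc) ct.
rewrite zc expr0n/= real_exprn_even_le0//= => /eqP zt.
by move: neg; rewrite zt mulr0 ltxx.
Qed.

Lemma gradient_flow_sign_dominated s t : 0 < s -> s <= t ->
  sign_dominated (K *m u t) (K *m u s).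
Proof.
move=> s0 st l; split; first exact: gradient_flow_sign.
move=> zs; have := gradient_flow_sqr_nonincreasing l s0 st.
by rewrite zs expr0n/= real_exprn_even_le0//= => /eqP.
Qed.

(** The negative velocities are subgradients, hence bounded by [J] in every
    direction; integrate. *)
Lemma gradient_flow_increment w s t : 0 < s -> s <= t ->
  dotv (u s - u t) w <= (t - s) * J w.
Proof.
move=> s0 st; rewrite dotvDl dotvNl.
suff : - dotv (u t) w + - J w * t <= - dotv (u s) w + - J w * s by lra.
apply: (@abs_continuous_nonincreasing _ s t
  (fun x => - dotv (u x) w + - J w * x)) => //.
  apply: abs_continuousD.
    under eq_fun do rewrite -dotvNr; exact: acu.
  apply: abs_continuousM; first exact: abs_continuous_cst.
  apply: (@abs_continuous_lipschitz _ _ _ 1) => // x y _ xy _.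
  by rewrite mul1r ger0_norm// subr_ge0.
case: hu => _ _; apply: filterS; first exact: (ae_filter_ringOfSetsType lebesgue_measure).
move=> x hx /andP[sx _]; have [ux px] := hx (lt_le_trans s0 sx).
have dx := is_deriveD (is_deriveN (is_derive_dotv w ux))
  (is_deriveZ (- J w) (is_derive_id x (1 : R))).
apply: (is_derive_le0_increment dx).
have /subdifferential_l1P[_ /(_ w)] := px.
by rewrite /GRing.scale/= mulr1 dotvNl; lra.
Qed.

(** At almost every time [x <= t] the subgradient [p x] remains a subgradient
    at [u t], so that its pairing with [u t] is exactly [J (u t)]; integrate
    from [s] to [t]. *)
Lemma gradient_flow_increment_self s t : 0 < s -> s <= t ->
  dotv (u s - u t) (u t) = (t - s) * J (u t).
Proof.
move=> s0 st; apply/eqP; rewrite eq_le gradient_flow_increment//=.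
set w := u t; rewrite dotvDl dotvNl -/w.
suff : dotv (u t) w + J w * t <= dotv (u s) w + J w * s by rewrite -/w; lra.
apply: (@abs_continuous_nonincreasing _ s t
  (fun x => dotv (u x) w + J w * x)) => //.
  apply: abs_continuousD; first exact: acu.
  apply: abs_continuousM; first exact: abs_continuous_cst.
  apply: (@abs_continuous_lipschitz _ _ _ 1) => // x y _ xy _.
  by rewrite mul1r ger0_norm// subr_ge0.
case: hu => _ _; apply: filterS; first exact: (ae_filter_ringOfSetsType lebesgue_measure).
move=> x hx /andP[sx xt]; have [ux px] := hx (lt_le_trans s0 sx).
have dx := is_deriveD (is_derive_dotv w ux)
  (is_deriveZ (J w) (is_derive_id x (1 : R))).
apply: (is_derive_le0_increment dx).
have wx := gradient_flow_sign_dominated (lt_le_trans s0 sx) (ltW xt).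
rewrite /GRing.scale/= mulr1 dotvNl (subdifferential_sign_dominated px wx).
by rewrite addNr.
Qed.

Let right0 w : dotv (u s) w @[s --> 0^'+] --> dotv f w.
Proof.
have <- : u 0 = f by case: hu.
by apply: cvg_dotv => i; [exact: strong_curve_right0|exact: cvg_cst].
Qed.

(** The mean of the negative velocities over [[0, t]] is again a subgradient at
    [u t]: let the initial time tend to zero in the two increment formulas. *)
Lemma gradient_flow_subdifferential t : 0 < t ->
  subdifferential J (u t) (t^-1 *: (f - u t)).
Proof.
move=> t0; have cvgl w c : dotv (u s - u t) w + (s - t) * c @[s --> 0^'+] -->
    dotv (f - u t) w + (0 - t) * c.
  under eq_fun do rewrite dotvDl; rewrite dotvDl.
  apply: cvgD; first by apply: cvgD; [exact: right0|exact: cvg_cst].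
  apply: cvgMl; apply: cvgB; last exact: cvg_cst.
  by apply: cvg_at_right_filter; exact: cvg_id.
have near0 : \forall s \near 0^'+, 0 < s /\ s <= t.
  near=> s; split; first by [].
  by near: s; exact: nbhs_right_le.
have le_lim w : dotv (f - u t) w <= t * J w.
  rewrite -subr_le0 -mulNr -(sub0r t).
  apply: (closed_cvg _ (@closed_le _ 0) _ _ (cvgl w (J w))).
  apply: filterS near0 => s [s0 st].
  by have := gradient_flow_increment w s0 st; rewrite /=; lra.
apply/subdifferential_l1P; split=> [|v]; last first.
  by rewrite dotvZl ler_pdivrMl.
rewrite dotvZl; suff -> : dotv (f - u t) (u t) = t * J (u t).
  by rewrite mulKf ?gt_eqF.
apply/eqP; rewrite eq_le le_lim/= -subr_ge0 -mulNr -(sub0r t).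
apply: (closed_cvg _ (@closed_ge _ 0) _ _ (cvgl (u t) (J (u t)))).
apply: filterS near0 => s [s0 st].
by have := gradient_flow_increment_self s0 st; rewrite /=; lra.
Unshelve. all: by end_near. Qed.

Lemma gradient_flow_lipschitz i s t : 0 < s -> s <= t ->
  `|u t i 0 - u s i 0| <= (J (delta_mx i 0) + 1) * (t - s).
Proof.
move=> s0 st; set e := delta_mx i 0.
have J0 := l1_analysis_ge0 K e.
have h1 := gradient_flow_increment e s0 st.
have h2 := gradient_flow_increment (-1 *: e) s0 st.
move: h1 h2; rewrite l1_analysisZ normrN normr1 mul1r dotvZr dotv_delta !mxE.
rewrite ler_norml => h1 h2; have : 0 <= t - s by lra.
by move=> ts; apply/andP; split; nra.
Qed.

End gradient_flow_theory.

(** * The inverse scale space flow *)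

(** The remainder of the comparison argument in one coordinate: a product of
    two increments of order [h], plus a bounded factor times an error of order
    [eta * h], is at most [e * h] for suitable [eta] and small [h]. *)
Lemma small_increment_product (R : realType) (A B M e : R) :
  0 <= A -> 0 <= B -> 0 < M -> 0 < e ->
  exists2 eta : R, 0 < eta &
    exists2 r : R, 0 < r & forall h : R, 0 < h -> h < r ->
      h * (eta + A) * (h * B) + M * (eta * h) <= e * h.
Proof.
move=> A0 B0 M0 e0; exists (e / (2 * M)); first by rewrite divr_gt0// mulr_gt0.
set eta := e / (2 * M).
have eta0 : 0 < eta by rewrite divr_gt0// mulr_gt0.
have P0 : 0 < (eta + A) * B + 1 by rewrite ltr_wpDl// mulr_ge0// addr_ge0// ltW.
exists (e / (2 * ((eta + A) * B + 1))); first by rewrite divr_gt0// mulr_gt0.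
move=> h h0 hlt.
have Me : M * (eta * h) = e / 2 * h by rewrite /eta; field; rewrite gt_eqF.
rewrite Me; have -> : h * (eta + A) * (h * B) = h * ((eta + A) * B * h) by ring.
suff : (eta + A) * B * h <= e / 2 by move=> H; nra.
apply: (@le_trans _ _ (((eta + A) * B + 1) * h)); first by nra.
rewrite -ler_pdivlMl//; apply: (le_trans (ltW hlt)).
by rewrite le_eqVlt; apply/orP; left; apply/eqP; field; rewrite gt_eqF.
Qed.

Section inverse_scale_space_theory.
Context (R : realType) (m n : nat) (K : 'M[R]_(m, n)) (f : 'cV[R]_n).
Context (u p v q : R -> 'cV[R]_n).
Hypothesis hK : diag_dominant (K *m K^T).
Hypothesis hu : gradient_flow (l1_analysis K) f u p.
Hypothesis hv : inverse_scale_space_flow (l1_analysis K) f v q.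
Notation J := (l1_analysis K).

(** One-dimensional Kelvin transform of the gradient flow; its derivative turns
    out to be the primal variable of the inverse scale space flow. *)
Definition kelvin (s : R) : 'cV[R]_n := s *: u s^-1.

(** The dual variable of the variational method at time [1 / s]. *)
Definition dual_flow (s : R) : 'cV[R]_n := s *: (f - u s^-1).

Lemma dual_flow_subdifferential s : 0 < s ->
  subdifferential J (u s^-1) (dual_flow s).
Proof.
move=> s0; have := gradient_flow_subdifferential hK hu (t := s^-1).
by rewrite invr_gt0 invrK; exact.
Qed.

(** With [a] and [b] the values of a coordinate of [K u] at the times [1 / s']
    and [1 / s], in this order, [b] lies between [0] and [a] and [s <= s'], so
    [s' * a - s * b] has the sign of [a] and vanishes with it. *)
Lemma kelvin_increment_sign_dominated s s' : 0 < s -> s <= s' ->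
  sign_dominated (K *m (kelvin s' - kelvin s)) (K *m u s'^-1).
Proof.
move=> s0 ss'; have s'0 := lt_le_trans s0 ss'.
have t'0 : 0 < s'^-1 by rewrite invr_gt0.
have t't : s'^-1 <= s^-1 by rewrite lef_pV2.
move=> l; have := gradient_flow_sign_dominated hK hu t'0 t't l.
have := gradient_flow_sqr_nonincreasing hK hu l t'0 t't.
have -> : (K *m (kelvin s' - kelvin s)) l 0 =
          s' * (K *m u s'^-1) l 0 - s * (K *m u s^-1) l 0.
  by rewrite mulmxBr -!scalemxAr !mxE.
set a := (K *m u s'^-1) l 0; set b := (K *m u s^-1) l 0 => ba [ab ab0].
split; last by move=> a0; rewrite ab0// a0 !mulr0 subrr.
have ab2 : a * b <= a ^+ 2 by have := sqr_ge0 (a - b); rewrite sqrrB; lra.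
have : s * (a * b) <= s * a ^+ 2 by rewrite ler_pM2l.
have : s * a ^+ 2 <= s' * a ^+ 2 by rewrite ler_wpM2r ?sqr_ge0.
by rewrite mulrBr (mulrCA a) (mulrCA a s) -expr2; lra.
Qed.

(** As [kelvin s' - kelvin s = (s' - s) *: f - (dual_flow s' - dual_flow s)],
    this says that [dual_flow] satisfies the implicit Euler scheme of the
    inverse scale space flow exactly, for every step [s' - s]. *)
Lemma dual_flow_kelvin_increment s s' : 0 < s -> s <= s' ->
  dotv (dual_flow s') (kelvin s' - kelvin s) = J (kelvin s' - kelvin s).
Proof.
move=> s0 ss'; apply: subdifferential_sign_dominated.
  exact: dual_flow_subdifferential (lt_le_trans s0 ss').
exact: kelvin_increment_sign_dominated.
Qed.

(** Away from [0] the factor [s] and the time [s^-1] are controlled, and [u] is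
    Lipschitz. *)
Lemma kelvin_lipschitz i a : 0 < a ->
  exists2 C : R, 0 < C & forall s s', a <= s -> s <= s' ->
    `|kelvin s' i 0 - kelvin s i 0| <= C * (s' - s).
Proof.
move=> a0; pose L := J (delta_mx i 0) + 1.
have L0 : 0 < L by rewrite ltr_wpDl// l1_analysis_ge0.
exists (`|f i 0| + 2 * L / a) => [|s s' as_ ss'].
  by rewrite ltr_wpDl// divr_gt0// mulr_gt0.
have s0 := lt_le_trans a0 as_; have s'0 := lt_le_trans s0 ss'.
have t'0 : 0 < s'^-1 by rewrite invr_gt0.
have t't : s'^-1 <= s^-1 by rewrite lef_pV2.
have lip := gradient_flow_lipschitz hu i t'0 t't.
have fu : `|f i 0 - u s'^-1 i 0| <= L * s'^-1.
  have /subdifferential_l1P[_ le_J] := dual_flow_subdifferential s'0.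
  have h1 := le_J (delta_mx i 0); have h2 := le_J (-1 *: delta_mx i 0).
  move: h1 h2; rewrite l1_analysisZ normrN normr1 mul1r dotvZr dotv_delta !mxE.
  move=> h1 h2; rewrite -(ler_pM2r s'0) mulfVK ?gt_eqF//.
  rewrite -[X in _ * X <= _](gtr0_norm s'0) -normrM mulrC ler_norml /L.
  by apply/andP; split; lra.
have -> : kelvin s' i 0 - kelvin s i 0 =
   (s' - s) * f i 0 - (s' - s) * (f i 0 - u s'^-1 i 0)
    - s * (u s^-1 i 0 - u s'^-1 i 0).
  by rewrite !mxE; ring.
have ss'0 : 0 <= s' - s by lra.
apply: (le_trans (ler_normB _ _)).
apply: (@le_trans _ _ ((s' - s) * `|f i 0| + (s' - s) * (L * s'^-1) +
                       s * (L * (s^-1 - s'^-1)))).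
  apply: lerD; last by rewrite normrM (gtr0_norm s0) ler_pM2l.
  apply: (le_trans (ler_normB _ _)).
  by rewrite !normrM (ger0_norm ss'0) lerD2l ler_wpM2l.
have -> : s * (L * (s^-1 - s'^-1)) = (s' - s) * (L * s'^-1).
  by field; rewrite !gt_eqF.
have -> : (`|f i 0| + 2 * L / a) * (s' - s) =
  (s' - s) * `|f i 0| + (s' - s) * (L * a^-1) + (s' - s) * (L * a^-1) by ring.
rewrite -!addrA lerD2l; apply: lerD; rewrite ler_wpM2l// ler_pM2l// lef_pV2//;
  exact: le_trans ss'.
Qed.

Let E s := dotv (q s - dual_flow s) (q s - dual_flow s).

Let acq i a b : 0 < a -> a <= b ->
  abs_continuous a b (fun s => (q s - dual_flow s) i 0).
Proof.
move=> a0 ab; have -> : (fun s => (q s - dual_flow s) i 0) =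
    (fun s => (coordf q i s - s * f i 0) + kelvin s i 0).
  by apply/funext => s; rewrite /coordf !mxE; ring.
have aci : abs_continuous a b (fun s : R => s).
  apply: (@abs_continuous_lipschitz _ _ _ 1) => // x y _ xy _.
  by rewrite mul1r ger0_norm// subr_ge0.
apply: abs_continuousD; last first.
  have [C C0 lip] := kelvin_lipschitz i a0.
  by apply: (abs_continuous_lipschitz C0) => x y ax xy _; exact: lip.
apply: abs_continuousB; last exact: abs_continuousM (abs_continuous_cst _ _ _).
by case: hv => /(_ i)[_ ac] _ _ _; exact: ac.
Qed.

(** With [D] the increment of [kelvin], expand the square and use the
    monotonicity of the subdifferential between [dual_flow s'], a subgradient
    at [D], and [q s], a subgradient at [v s]. What remains is quadratic in the
    step, up to the error in the first order expansion of [q]. *)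
Lemma dual_flow_distance_increment s s' : 0 < s -> s <= s' ->
  subdifferential J (v s) (q s) ->
  E s' - E s <= 2 * \sum_(i < n)
    ((q s' i 0 - q s i 0) *
       (kelvin s' i 0 - kelvin s i 0 - (s' - s) * v s i 0) +
     (q s' - dual_flow s') i 0 *
       (q s' i 0 - q s i 0 - (s' - s) * (f i 0 - v s i 0))).
Proof.
move=> s0 ss' /subdifferential_l1P[qv le_q]; set h := s' - s.
have s'0 := lt_le_trans s0 ss'; have h0 : 0 <= h by rewrite /h subr_ge0.
set D := kelvin s' - kelvin s; set dq := q s' - q s.
pose r := dq - h *: (f - v s).
have -> : \sum_(i < n)
    ((q s' i 0 - q s i 0) * (kelvin s' i 0 - kelvin s i 0 - h * v s i 0) +
     (q s' - dual_flow s') i 0 * (q s' i 0 - q s i 0 - h * (f i 0 - v s i 0))) =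
  dotv dq (D - h *: v s) + dotv (q s' - dual_flow s') r.
  by rewrite -big_split; apply: eq_bigr => i _; rewrite !mxE.
have Dr : q s' - dual_flow s' - (q s - dual_flow s) = r + (D - h *: v s).
  by apply/colP => i; rewrite !mxE /h; ring.
have /subdifferential_l1P[_ /(_ (v s)) le_Q] := dual_flow_subdifferential s'0.
(* convexity of the square: only the increment of [q - dual_flow] is needed to
   first order, paired with the endpoint at [s'] *)
have QD := dual_flow_kelvin_increment s0 ss'; rewrite -/D in QD.
have qD := le_q D.
have dE : E s' - E s <= 2 * dotv (q s' - dual_flow s') (r + (D - h *: v s)).
  rewrite -Dr /E; move: (q s' - _) (q s - _) => x y.
  by have := dotv_ge0 (x - y); rewrite !dotvE (dotvC y x); lra.
apply: (le_trans dE); rewrite ler_pM2l// dotvDr addrC lerD2r.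
have : h * dotv (dual_flow s') (v s) <= h * J (v s) by rewrite ler_wpM2l.
rewrite -{}qv /dq; clear dE Dr r dq le_Q.
move: (dual_flow s') D QD qD => Q D QD qD.
by rewrite !dotvE; lra.
Qed.

Lemma dual_flow_distance_nonincreasing a b : 0 < a -> a <= b -> E b <= E a.
Proof.
move=> a0 ab; apply: abs_continuous_nonincreasing => //.
  by apply: abs_continuous_sum => i; apply: abs_continuousM; exact: acq.
case: hv => _ _ _; apply: filterS; first exact: (ae_filter_ringOfSetsType lebesgue_measure).
move=> s hs /andP[as_ sb] e e0; have s0 := lt_le_trans a0 as_.
have [qs pqs] := hs s0.
(* the budget [e] is shared between the [n] coordinates *)
pose e' := e / (2 * (n%:R + 1)).
have n0 : 0 < n%:R + 1 :> R by rewrite ltr_wpDl.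
have e'0 : 0 < e' by rewrite divr_gt0// mulr_gt0.
have coord i : exists2 r : R, 0 < r & forall h : R, 0 < h -> h < r ->
    (q (s + h) i 0 - q s i 0) *
      (kelvin (s + h) i 0 - kelvin s i 0 - h * v s i 0) +
    (q (s + h) - dual_flow (s + h)) i 0 *
      (q (s + h) i 0 - q s i 0 - h * (f i 0 - v s i 0)) <= e' * h.
  have [C C0 lip] := kelvin_lipschitz i a0.
  have [M M0 bdM] := abs_continuous_bounded (acq i a0 ab).
  have [eta eta0 [r1 r10 small]] := small_increment_product
    (normr_ge0 (f i 0 - v s i 0)) (addr_ge0 (ltW C0) (normr_ge0 (v s i 0))) M0 e'0.
  have [r2 r20 qinc] := is_derive_increment (qs i) eta0.
  exists (Num.min (b - s) (Num.min r1 r2)) => [|h h0].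
    by rewrite !lt_min subr_gt0 sb r10.
  rewrite !lt_min => /andP[hb /andP[hr1 hr2]].
  apply: le_trans (small h h0 hr1).
  have := qinc h h0 hr2; rewrite /coordf.
  have -> : (f - v s) i 0 = f i 0 - v s i 0 by rewrite !mxE.
  set rr := _ - _ - _ => rrle.
  apply: (le_trans (ler_norm _)); apply: (le_trans (ler_normD _ _)).
  rewrite !normrM; apply: lerD; apply: ler_pM => //.
  - have -> : q (s + h) i 0 - q s i 0 = rr + h * (f i 0 - v s i 0).
      by rewrite /rr; ring.
    apply: (le_trans (ler_normD _ _)); rewrite normrM (gtr0_norm h0) mulrDr.
    by rewrite lerD2r mulrC.
  - apply: (le_trans (ler_normB _ _)); rewrite normrM (gtr0_norm h0) mulrDr.
    rewrite lerD2r; have := lip s (s + h) as_.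
    have -> : s + h - s = h by ring.
    by rewrite lerDl (mulrC C) => /(_ (ltW h0)).
  - by apply: bdM; apply/andP; split; lra.
have [r r0 hr] := fin_all_exists2 coord.
exists (\big[Num.min/1]_i r i).
  by apply: lt_bigmin => // ; exact: ltr01.
move=> h h0 hlt; rewrite -lerBlDl.
have := @dual_flow_distance_increment s (s + h) s0 _ pqs.
rewrite lerDl => /(_ (ltW h0)) /=; rewrite addrAC subrr add0r => /le_trans; apply.
have -> : e * h = 2 * ((n%:R + 1) * (e' * h)).
  by rewrite /e'; field; rewrite gt_eqF.
rewrite ler_pM2l//.
apply: (@le_trans _ _ (\sum_(i < n) e' * h)).
  apply: ler_sum => i _; apply: hr => //; apply: (lt_le_trans hlt).
  exact: bigmin_le_cond.
rewrite sumr_const card_ord -[leLHS]mulr_natl ler_pM2r ?mulr_gt0//.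
by rewrite lerDl.
Qed.

(** The squared distance is nonincreasing and tends to zero at [0], because [q
    0 = 0] and [|f - u(1/r)| <= |f|]. *)
Lemma inverse_scale_space_dual_flow s : 0 < s -> q s = dual_flow s.
Proof.
move=> s0; apply/eqP; rewrite -subr_eq0; apply/eqP/dotv_le0_eq0.
have q0 : q 0 = 0 by case: hv.
have sq : strong_curve q by case: hv.
have bd r : 0 < r -> r <= s -> E s <= 2 * dotv (q r) (q r) + 2 * (r ^+ 2 * dotv f f).
  move=> r0 rs; apply: (le_trans (dual_flow_distance_nonincreasing r0 rs)).
  have Qr : dotv (dual_flow r) (dual_flow r) <= r ^+ 2 * dotv f f.
    rewrite dotvZl dotvZr mulrA -expr2 ler_wpM2l ?sqr_ge0//.
    have /subdifferential_l1P[Qu _] := dual_flow_subdifferential r0.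
    have := l1_analysis_ge0 K (u r^-1); rewrite -Qu dotvZl pmulr_rge0//.
    have := dotv_ge0 (u r^-1).
    by rewrite !dotvE (dotvC (u r^-1) f); lra.
  rewrite /E; move: (dual_flow r) Qr => Q Qr.
  by have := dotv_ge0 (q r + Q); rewrite !dotvE (dotvC Q); lra.
have cvgbd : 2 * dotv (q r) (q r) + 2 * (r ^+ 2 * dotv f f) @[r --> 0^'+] -->
    2 * dotv (q 0) (q 0) + 2 * (0 ^+ 2 * dotv f f).
  apply: cvgD; apply: cvgMr.
    by apply: cvg_dotv => i; exact: strong_curve_right0.
  apply: cvgMl; apply: cvg_at_right_filter.
  exact: exprn_continuous.
rewrite q0 dotv0r expr0n/= mul0r !mulr0 addr0 in cvgbd.
apply: (closed_cvg _ (@closed_ge _ (E s)) _ _ cvgbd).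
near=> r; apply: bd; first by [].
by near: r; exact: nbhs_right_le.
Unshelve. all: by end_near. Qed.

End inverse_scale_space_theory.

(** * The fundamental theorem of calculus for absolutely continuous functions *)

(** Derivatives are controlled off a null set, hence a bound that holds almost
    everywhere. *)
Lemma ae_bounded_integrable d (T : measurableType d) (R : realType)
    (mu : {measure set T -> \bar R}) (D : set T) (h : T -> R) (M : R) :
  measurable D -> (mu D < +oo)%E -> measurable_fun D h ->
  {ae mu, forall x, D x -> `|h x| <= M} ->
  mu.-integrable D (EFin \o h) /\
  `|\int[mu]_(x in D) h x| <= `|M| * fine (mu D).
Proof.
move=> mD Dfin mh bd.
have /measurable_EFinP mh' := mh.
have le_int : (\int[mu]_(x in D) `|(h x)%:E| <= `|M|%:E * mu D)%E.
  rewrite -integral_cst//; apply: ae_ge0_le_integral => //.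
  - exact: measurableT_comp.
  - by move=> x _; rewrite lee_fin.
  move: bd; apply: filterS => x bx Dx; rewrite lee_fin.
  exact: le_trans (bx Dx) (ler_norm _).
have ih : mu.-integrable D (EFin \o h).
  apply/integrableP; split; first exact: mh'.
  by apply: (le_lt_trans le_int); rewrite lte_mul_pinfty// lee_fin.
split=> //; apply: (le_trans (le_normr_Rintegral mD ih)).
rewrite /Rintegral -lee_fin EFinM fineK; last first.
  exact/integrable_fin_num/(integrable_norm ih).
by rewrite fineK// ge0_fin_numE.
Qed.

Section abs_continuous_FTC.
Context (R : realType).
Notation mu := (@lebesgue_measure R).

(** The indefinite integral of [h] is Lipschitz with derivative [h] almost
    everywhere by Lebesgue differentiation, so its difference with [g] is
    monotone both ways. *)
Lemma abs_continuous_FTC (a b M : R) (g h : R -> R) :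
  a <= b -> abs_continuous a b g -> measurable_fun `[a, b] h ->
  {ae lebesgue_measure, forall x, a <= x <= b ->
     is_derive x (1 : R) g (h x) /\ `|h x| <= M} ->
  lebesgue_measure.-integrable `[a, b] (EFin \o h) /\
  \int[lebesgue_measure]_(x in `[a, b]) h x = g b - g a.
Proof.
move=> ab acg mh aeh.
have aeF : Filter (nbhs (almost_everywhere mu)).
  exact: (ae_filter_ringOfSetsType mu).
have mitv (i : interval R) : @measurable _ (measurableTypeR R) [set` i].
  exact: (@measurable_itv R i).
have mh' (D : set R) : @measurable _ (measurableTypeR R) D -> D `<=` `[a, b] ->
    @measurable_fun _ _ (measurableTypeR R) R D h.
  by move=> mD Dab; exact: (measurable_funS (mitv `[a, b]) Dab mh).
have muitv x y : x <= y -> mu [set` `]x, y]] = (y - x)%:E.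
  rewrite lebesgue_measure_itv/= lte_fin le_eqVlt => /predU1P[->|->//].
  by rewrite ltxx subrr.
have muab : (mu [set` `[a, b]] < +oo)%E.
  by rewrite lebesgue_measure_itv/=; case: ifP => _; exact: ltry.
have sub_ae (D : set R) : D `<=` `[a, b] ->
    {ae mu, forall x, D x -> `|h x| <= M}.
  move=> Dab; apply: filterS aeh => x hx /Dab; rewrite /= in_itv/=.
  by move=> /hx[].
have ih : mu.-integrable `[a, b] (EFin \o h).
  by have [] := ae_bounded_integrable (mitv `[a, b]) muab (mh' _ (mitv _) (fun x p => p)) (sub_ae _ (fun x p => p)).
split=> //.
pose hab := h \_ `[a, b].
have ihab (D : set R) : @measurable _ (measurableTypeR R) D -> mu.-integrable D (EFin \o hab).
  move=> mD; rewrite /hab -restrict_EFin; apply/integrable_restrict => //.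
  apply: (@integrableS _ _ _ mu `[a, b]) => //.
  by apply: measurableI.
(* starting the primitive left of [a] makes its derivative available at [a] *)
pose G x := \int[mu]_(t in `[a - 1, x]) hab t.
have GB x y : a <= x -> x <= y -> y <= b ->
    G y - G x = \int[mu]_(t in `]x, y]) h t.
  move=> ax xy yb; rewrite /G Rintegral_itvB ?bnd_simp//; last 2 first.
  - exact: ihab.
  - by lra.
  apply: eq_Rintegral => t; rewrite inE/= in_itv/= => /andP[xt ty].
  rewrite /hab patchE mem_set//= in_itv/= (le_trans ty yb) andbT.
  exact: le_trans ax (ltW xt).
have G' : {ae mu, forall x, a <= x -> derivable G x 1 /\ derive1 G x = hab x}.
  have := @FTC1 R hab (BLeft (a - 1)) (fun y => ihab _ (mitv _))
    (integrable_locally (mitv _) ih).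
  by apply: filterS => x Gx ax; apply: Gx; rewrite /= lte_fin; lra.
have lipG x y : a <= x -> x <= y -> y <= b -> `|G y - G x| <= (`|M| + 1) * (y - x).
  move=> ax xy yb.
  have Dab : `]x, y] `<=` `[a, b].
    move=> t; rewrite /= !in_itv/= => /andP[xt ty].
    by rewrite (le_trans ax (ltW xt)) (le_trans ty).
  rewrite GB//.
  have muxy : (mu [set` `]x, y]] < +oo)%E by rewrite muitv ?ltry.
  have [_ le_M] := ae_bounded_integrable (mitv `]x, y]) muxy (mh' _ (mitv _) Dab) (sub_ae _ Dab).
  apply: (le_trans le_M).
  rewrite [X in _ * X <= _](_ : _ = y - x); last first.
    exact: (congr1 fine (muitv x y xy)).
  rewrite ler_wpM2r ?subr_ge0//.
  by rewrite lerDl.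
have acG : abs_continuous a b G.
  by apply: (abs_continuous_lipschitz _ lipG); rewrite ltr_wpDl.
have aed : {ae mu, forall x, a <= x < b -> exists d : R,
    is_derive x (1 : R) g d /\ is_derive x (1 : R) G d}.
  apply: filterS2 aeh G' => x hx Gx /andP[ax xb].
  have [gx _] : is_derive x (1 : R) g (h x) /\ `|h x| <= M by apply: hx; rewrite ax ltW.
  exists (h x); split=> //; have [dG GE'] := Gx ax.
  apply: DeriveDef => //; rewrite -derive1E GE' /hab patchE mem_set//=.
  by rewrite in_itv/= ax ltW.
have le1 : g b - G b <= g a - G a.
  apply: (@abs_continuous_nonincreasing _ a b (fun x => g x - G x)) => //.
    exact: abs_continuousB.
  apply: filterS aed => x hx /hx[d [gd Gd]].
  by apply: (is_derive_le0_increment (is_deriveB gd Gd)); rewrite subrr.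
have le2 : G b - g b <= G a - g a.
  apply: (@abs_continuous_nonincreasing _ a b (fun x => G x - g x)) => //.
    exact: abs_continuousB.
  apply: filterS aed => x hx /hx[d [gd Gd]].
  by apply: (is_derive_le0_increment (is_deriveB Gd gd)); rewrite subrr.
rewrite -Rintegral_itv_obnd_cbnd; last first.
  apply: integrableS ih; [exact: mitv|exact: mitv|].
  by apply: subset_itvr; rewrite bnd_simp.
by rewrite -GB//; move: le1 le2; lra.
Qed.

End abs_continuous_FTC.

(** * Test functions under inversion of the variable *)

Lemma is_derive_lipschitz_le (R : realType) (g : R -> R) (x d C r : R) :
  is_derive x 1 g d -> 0 < r ->
  (forall h : R, 0 < h -> h < r -> `|g (x + h) - g x| <= C * h) -> `|d| <= C.
Proof.
move=> gd r0 lip; apply/ler_addgt0Pr => e e0.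
have [r' r'0 inc] := is_derive_increment gd e0.
pose h := Num.min r r' / 2.
have m0 : 0 < Num.min r r' by rewrite lt_min r0.
have h0 : 0 < h by rewrite divr_gt0.
have hr : h < r by rewrite (@lt_le_trans _ _ (Num.min r r'))// ?ge_min ?lexx// /h; lra.
have hr' : h < r' by rewrite (@lt_le_trans _ _ (Num.min r r'))// ?ge_min ?lexx ?orbT// /h; lra.
rewrite -(ler_pM2l h0) -{1}(gtr0_norm h0) -normrM.
have := ler_normB (g (x + h) - g x) (g (x + h) - g x - h * d).
by rewrite opprB addrCA subrr addr0; have := lip h h0 hr; have := inc h h0 hr'; lra.
Qed.

Lemma continuous_itv_bounded (R : realType) (a b : R) (g : R -> R) :
  a <= b -> {within `[a, b], continuous g} ->
  exists2 M : R, 0 < M & forall x, a <= x <= b -> `|g x| <= M.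
Proof.
move=> ab cg.
have [c1 _ max1] := EVT_max ab cg; have [c2 _ min2] := EVT_min ab cg.
exists (`|g c1| + `|g c2| + 1) => [|x xab]; first by rewrite ltr_wpDl// addr_ge0.
have xab' : x \in `[a, b] by rewrite in_itv.
have le1 := le_trans (max1 x xab') (ler_norm _).
have le2 : - g x <= `|g c2|.
  by rewrite -normrN; apply: le_trans (ler_norm _); rewrite lerN2 min2.
rewrite ler_norml lerNl; apply/andP; split.
  by apply: (le_trans le2); rewrite -addrA addrCA lerDl addr_ge0.
by apply: (le_trans le1); rewrite -addrA lerDl addr_ge0.
Qed.

Lemma abs_continuous_is_derive (R : realType) (a b : R) (g dg : R -> R) :
  a <= b -> (forall x, a <= x <= b -> is_derive x (1 : R) g (dg x)) ->
  {within `[a, b], continuous dg} -> abs_continuous a b g.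
Proof.
move=> ab gdg cdg.
have [M M0 bM] := continuous_itv_bounded ab cdg.
apply: (abs_continuous_lipschitz M0) => x y ax xy yb.
have gxy t : t \in `[x, y] -> is_derive t (1 : R) g (dg t).
  by rewrite in_itv/= => /andP[xt ty]; apply: gdg; rewrite (le_trans ax)//= (le_trans ty).
have cg : {within `[x, y], continuous g}.
  by apply: derivable_within_continuous => t /gxy[].
have goo t : t \in `]x, y[ -> is_derive t (1 : R) g (dg t).
  by move=> /subset_itv_oo_cc; exact: gxy.
have [c cxy ->] := MVT_segment xy goo cg.
have yx0 : 0 <= y - x by rewrite subr_ge0.
rewrite normrM (ger0_norm yx0) ler_wpM2r//.
apply: bM; move: cxy; rewrite in_itv/= => /andP[xc cy].
by rewrite (le_trans ax)//= (le_trans cy).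
Qed.

Lemma derive1_eq0_outside (R : realType) (a b : R) (g : R -> R) :
  (forall t, ~ (a <= t <= b) -> g t = 0) ->
  forall t, ~ (a <= t <= b) -> derive1 g t = 0.
Proof.
move=> g0 t tab; rewrite derive1E (@near_eq_derive _ _ _ g (cst 0)) ?derive_cst//.
have [ta|at_] := ltP t a.
  apply: filterS (lt_nbhsl ta) => s sa; rewrite g0// => /andP[as_ _].
  by move: sa; rewrite ltNge as_.
have bt : b < t by rewrite ltNge; apply/negP => tb; apply: tab; rewrite at_.
apply: filterS (lt_nbhsr bt) => s bs; rewrite g0// => /andP[_ sb].
by move: bs; rewrite ltNge sb.
Qed.

Lemma Rintegral_supported (R : realType) (D E : set R) (h : R -> R) :
  E `<=` D -> (forall x, D x -> ~ E x -> h x = 0) ->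
  \int[lebesgue_measure]_(x in D) h x = \int[lebesgue_measure]_(x in E) h x.
Proof.
move=> ED h0; rewrite Rintegral_mkcond [RHS]Rintegral_mkcond; congr Rintegral.
apply/funext => x; rewrite !patchE.
have [xE|xE] := pselect (E x); first by rewrite !mem_set//; exact: ED.
rewrite [in RHS]memNset//; have [xD|xD] := pselect (D x); last by rewrite memNset.
by rewrite mem_set// h0.
Qed.

Lemma is_derive_continuous (R : realType) (g : R -> R) (x d : R) : is_derive x (1 : R) g d ->
  {for x, continuous g}.
Proof. by case=> dg _; apply: differentiable_continuous; exact/derivable1_diffP. Qed.

Section kelvin_transform.
Context (R : realType) (w : R -> R).
Hypothesis dw : forall k t, derivable (derive1n k w) t 1.
Notation w1 := (derive1 w).
Notation w2 := (derive1 (derive1 w)).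

Let w'E k t : is_derive t (1 : R) (derive1n k w) (derive1n k.+1 w t).
Proof. by apply: DeriveDef; [exact: dw|rewrite /= derive1E]. Qed.

(** The second derivative of [t |-> t * w t]. *)
Definition mulX_derive2 (t : R) : R := t * w2 t + 2 * w1 t.

Lemma mulX_derive2E :
  derive1 (derive1 (fun t => t * w t)) = mulX_derive2.
Proof.
have -> : derive1 (fun t => t * w t) = (fun t => w t + t * w1 t).
  apply/funext => t; rewrite derive1E.
  have D := is_deriveM (is_derive_id t (1 : R)) (w'E 0 t).
  have [_ Dv] := D; apply: (etrans Dv).
  by rewrite /GRing.scale/= mulr1 addrC.
apply/funext => t; rewrite derive1E.
have D := is_deriveD (w'E 0 t) (is_deriveM (is_derive_id t (1 : R)) (w'E 1 t)).
have [_ Dv] := D; apply: (etrans Dv).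
by rewrite /mulX_derive2 /GRing.scale/=; ring.
Qed.

Lemma is_derive_inv (s : R) : s != 0 ->
  is_derive s (1 : R) (fun s => s^-1) (- (s^-1 * s^-1)).
Proof.
move=> s0; have := @is_deriveV R id s 1 1 s0 (is_derive_id s (1 : R)).
by move/is_derive_eq; apply; rewrite /GRing.scale/= mulr1 -exprVn expr2.
Qed.

(** The derivative of [s |-> w (1/s)] away from [0]. *)
Definition inv_derive1 (s : R) : R := w1 s^-1 * - (s^-1 * s^-1).

Lemma is_derive_inv_var (s : R) : s != 0 ->
  is_derive s (1 : R) (fun s => w s^-1) (inv_derive1 s).
Proof.
by move=> s0; exact: (is_derive1_comp (w'E 0 s^-1) (is_derive_inv s0)).
Qed.

(** The second derivative of [s |-> w (1/s)] away from [0]. The factor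
    [mulX_derive2] is what makes [t * dtt] the counterpart of the frequency
    derivative. *)
Definition inv_derive2 (s : R) : R :=
  s^-1 * s^-1 * s^-1 * mulX_derive2 s^-1.

Lemma is_derive_inv_derive1 (s : R) : s != 0 ->
  is_derive s (1 : R) inv_derive1 (inv_derive2 s).
Proof.
move=> s0; have i := is_derive_inv s0.
have D := is_deriveM (is_derive1_comp (w'E 1 s^-1) i) (is_deriveN (is_deriveM i i)).
move: D => /is_derive_eq; apply.
rewrite /inv_derive2 /mulX_derive2 /GRing.scale/=.
have -> : (- ((fun s : R => s^-1) * (fun s : R => s^-1))) s = - (s^-1 * s^-1) by [].
ring.
Qed.

Lemma mulX_derive2_continuous : continuous mulX_derive2.
Proof.
move=> t; apply: cvgD; apply: cvgM; [exact: cvg_id| |exact: cvg_cst|].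
- exact: (is_derive_continuous (w'E 2 t)).
- exact: (is_derive_continuous (w'E 1 t)).
Qed.

Lemma inv_derive2_continuous (s : R) : s != 0 ->
  {for s, continuous inv_derive2}.
Proof.
move=> s0; have i := is_derive_continuous (is_derive_inv s0).
apply: cvgM; first by apply: cvgM => //; exact: cvgM.
by apply: continuous_comp => //; exact: mulX_derive2_continuous.
Qed.

End kelvin_transform.

(** * Pairing with test functions *)

Lemma integrable_supported (R : realType) (D E : set R) (h : R -> R) :
  measurable D -> measurable E -> E `<=` D ->
  (forall x, D x -> ~ E x -> h x = 0) ->
  lebesgue_measure.-integrable E (EFin \o h) ->
  lebesgue_measure.-integrable D (EFin \o h).
Proof.
move=> mD mE ED h0 ih.
have ihE : lebesgue_measure.-integrable D ((EFin \o h) \_ E).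
  by apply/integrable_restrict => //; rewrite setIidr.
apply: eq_integrable ihE => // x /set_mem Dx; rewrite patchE.
by case: ifPn => // /negP xE; rewrite /= h0// => /mem_set.
Qed.

Section kelvin_by_parts.
Context (R : realType) (w u v : R -> R) (a b : R).
Notation mu := (@lebesgue_measure R).
Hypothesis dw : forall k t, derivable (derive1n k w) t 1.
Hypothesis a0 : 0 < a.
Hypothesis w0 : forall t, ~ (a <= t <= b) -> w t = 0.
Hypothesis cu : {in `]0, +oo[, continuous u}.
Hypothesis mv : measurable_fun (`]0, +oo[ : set R) v.
Let y (s : R) := s * u s^-1.
Hypothesis lip_y : forall c : R, 0 < c -> exists2 C : R, 0 < C &
  forall s s' : R, c <= s -> s <= s' -> `|y s' - y s| <= C * (s' - s).
Hypothesis dy : {ae mu, forall s : R, 0 < s -> is_derive s (1 : R) y (v s)}.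

Let w10 t : ~ (a <= t <= b) -> derive1 w t = 0.
Proof. exact: derive1_eq0_outside. Qed.

Let w20 t : ~ (a <= t <= b) -> derive1 (derive1 w) t = 0.
Proof. exact: derive1_eq0_outside. Qed.

(* [1 / beta, 1 / alpha] contains [a, b] in its interior *)
Let beta := 2 / a.
Let alpha := (Num.max a b + 1)^-1.

Let alpha0 : 0 < alpha.
Proof. by rewrite invr_gt0 ltr_wpDl// le_max (ltW a0). Qed.

Let beta0 : 0 < beta.
Proof. by rewrite divr_gt0. Qed.

Let inv_alpha : a < alpha^-1 /\ b < alpha^-1.
Proof. by rewrite invrK !ltr_pwDr// ?le_max ?lexx ?orbT. Qed.

Let inv_beta : beta^-1 < a.
Proof. by rewrite /beta invf_div ltr_pdivrMr//; have := a0; lra. Qed.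

Let alpha_beta : alpha < beta.
Proof.
have [ha _] := inv_alpha; rewrite -ltf_pV2//; exact: lt_trans inv_beta ha.
Qed.

Let outside s : 0 < s -> s <= alpha \/ beta <= s -> ~ (a <= s^-1 <= b).
Proof.
move=> s0 [sa|bs] /andP[as_ sb].
- have : alpha^-1 <= s^-1 by rewrite lef_pV2.
  by have [_] := inv_alpha; lra.
- have : s^-1 <= beta^-1 by rewrite lef_pV2.
  by have := inv_beta; lra.
Qed.

Let psi0 s : 0 < s -> s <= alpha \/ beta <= s -> inv_derive1 w s = 0.
Proof. by move=> s0 sab; rewrite /inv_derive1 w10 ?mul0r//; exact: outside. Qed.

Let pos s : alpha <= s <= beta -> 0 < s.
Proof. by move=> /andP[+ _]; exact: lt_le_trans. Qed.

Let cpsi1 : {within `[alpha, beta], continuous (inv_derive2 w)}.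
Proof.
apply: continuous_in_subspaceT => s; rewrite inE/= in_itv/= => /pos s0.
by apply: inv_derive2_continuous => //; rewrite gt_eqF.
Qed.

Let dpsi s : alpha <= s <= beta ->
  is_derive s (1 : R) (inv_derive1 w) (inv_derive2 w s).
Proof. by move=> /pos s0; apply: is_derive_inv_derive1 => //; rewrite gt_eqF. Qed.

Let acpsi : abs_continuous alpha beta (inv_derive1 w).
Proof. exact: abs_continuous_is_derive (ltW alpha_beta) dpsi cpsi1. Qed.

Let acy : abs_continuous alpha beta y.
Proof.
have [C C0 lip] := lip_y alpha0.
by apply: (abs_continuous_lipschitz C0) => s s' as_ ss' _; exact: lip.
Qed.

Let within_measurable (g : R -> R) : {within `[alpha, beta], continuous g} ->
  measurable_fun `[alpha, beta] g.
Proof. by move=> cg; apply: subspace_continuous_measurable_fun => //. Qed.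

Let cypsi1 : {within `[alpha, beta], continuous (fun s => y s * inv_derive2 w s)}.
Proof.
have cy := abs_continuous_within acy.
by move=> s; apply: cvgM; [exact: cy|exact: cpsi1].
Qed.

Lemma kelvin_integration_by_parts :
  mu.-integrable `[alpha, beta] (EFin \o (fun s => v s * inv_derive1 w s)) /\
  - (\int[mu]_(s in `[alpha, beta]) (v s * inv_derive1 w s)) =
  \int[mu]_(s in `[alpha, beta]) (y s * inv_derive2 w s).
Proof.
have [C C0 lip] := lip_y alpha0.
have [M1 M10 b1] := abs_continuous_bounded acpsi.
have [M2 M20 b2] := abs_continuous_bounded acy.
have [M3 M30 b3] := continuous_itv_bounded (ltW alpha_beta) cpsi1.
pose h s := v s * inv_derive1 w s + y s * inv_derive2 w s.
have mvab : measurable_fun `[alpha, beta] v.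
  apply: measurable_funS mv => // s; rewrite /= !in_itv/= andbT; exact: pos.
have mh : measurable_fun `[alpha, beta] h.
  apply: measurable_funD; last exact: within_measurable.
  apply: measurable_funM => //; apply: within_measurable.
  exact: abs_continuous_within.
have aeh : {ae mu, forall s, alpha <= s <= beta ->
    is_derive s (1 : R) (fun s => y s * inv_derive1 w s) (h s) /\
    `|h s| <= C * M1 + M2 * M3}.
  move: dy; apply: filterS; first exact: (ae_filter_ringOfSetsType mu).
  move=> s hs sab; have ys := hs (pos sab); split.
    apply: (is_derive_eq (is_deriveM ys (dpsi sab))).
    by rewrite /h /GRing.scale/= addrC (mulrC (v s)).
  have [as_ sb] := andP sab.
  have vC : `|v s| <= C.
    apply: (is_derive_lipschitz_le ys ltr01) => e e0 _.
    have -> : e = s + e - s by ring.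
    by rewrite addrCA subrr addr0; apply: lip => //; rewrite lerDl ltW.
  apply: (le_trans (ler_normD _ _)); rewrite (normrM (v s)) (normrM (y s)).
  apply: lerD; apply: ler_pM => //.
  - exact: b1.
  - exact: b2.
  - exact: b3.
have [ih hE] := abs_continuous_FTC (ltW alpha_beta) (abs_continuousM acy acpsi) mh aeh.
have iy : mu.-integrable `[alpha, beta] (EFin \o (fun s => y s * inv_derive2 w s)).
  by apply: continuous_compact_integrable; [exact: segment_compact|exact: cypsi1].
split.
  have ihy : mu.-integrable `[alpha, beta]
      (fun s : R => (h s)%:E - (y s * inv_derive2 w s)%:E)%E.
    exact: (integrableB _ ih iy).
  apply: eq_integrable ihy => // s _.
  by rewrite /= -EFinB /h addrK.
have -> : \int[mu]_(s in `[alpha, beta]) (v s * inv_derive1 w s) =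
    \int[mu]_(s in `[alpha, beta]) (h s - y s * inv_derive2 w s).
  by apply: eq_Rintegral => s _; rewrite /h addrK.
rewrite RintegralB//.
rewrite hE (psi0 beta0); last by right.
by rewrite (psi0 alpha0) ?mulr0 ?subrr ?sub0r ?opprK//; left.
Qed.

(** The substitution [t = 1 / s]: one factor [s^-1] cancels against [y s = s *
    u (1/s)], the other two are the Jacobian. *)
Lemma kelvin_substitution :
  \int[mu]_(s in `[alpha, beta]) (y s * inv_derive2 w s) =
  \int[mu]_(t in `[beta^-1, alpha^-1]) (u t * mulX_derive2 w t).
Proof.
have pos' s : s \in `]alpha, beta[ -> 0 < s.
  by rewrite in_itv/= => /andP[as_ _]; exact: lt_trans as_.
have derE s : 0 < s -> derive1 (fun s : R => s^-1) s = - (s^-1 * s^-1).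
  by move=> s0; rewrite derive1E; have [_ ->] := is_derive_inv (lt0r_neq0 s0).
have cinv (s : R) : 0 < s -> {for s, continuous (fun s : R => s^-1)}.
  by move=> s0; exact: is_derive_continuous (is_derive_inv (lt0r_neq0 s0)).
have cder (s : R) : 0 < s -> {for s, continuous (derive1 (fun s : R => s^-1))}.
  move=> s0; rewrite /prop_for /continuous_at derE//.
  have c2 : - (x^-1 * x^-1) @[x --> s] --> - (s^-1 * s^-1).
    exact: (cvgN (cvgM (cinv s s0) (cinv s s0))).
  apply: cvg_trans c2.
  by apply: near_eq_cvg; apply: filterS (lt_nbhsr s0) => x /derE.
rewrite /Rintegral (@integration_by_substitution_decreasing _ (fun s => s^-1)
   (fun t => u t * mulX_derive2 w t) alpha beta) ?ltW//; last 6 first.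
- move=> s t sab tab; rewrite ltf_pV2// posrE; apply: pos.
  by move: tab; rewrite in_itv.
  by move: sab; rewrite in_itv.
- by move=> s /pos' s0; exact: cder.
- exact: cvgP (cvg_at_right_filter (cder alpha alpha0)).
- exact: cvgP (cvg_at_left_filter (cder beta beta0)).
- split.
  + by move=> s /pos' s0; have [] := is_derive_inv (lt0r_neq0 s0).
  + by apply: cvg_at_right_filter; exact: cinv.
  + by apply: cvg_at_left_filter; exact: cinv.
- apply: continuous_in_subspaceT => t; rewrite inE/= in_itv/= => /andP[bt _].
  have t0 : 0 < t by apply: lt_le_trans bt; rewrite invr_gt0.
  apply: cvgM; last exact: mulX_derive2_continuous.
  by apply: cu; rewrite in_itv/= t0.
congr fine; apply: eq_integral => s; rewrite inE/= in_itv/= => /pos s0.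
transitivity ((u s^-1 * mulX_derive2 w s^-1 *
  - derive1 (fun s : R => s^-1) s)%:E); last by [].
by rewrite derE// /y /inv_derive2; congr (_%:E); field; rewrite gt_eqF.
Qed.

Let D0 : set R := `]0, +oo[.

Let psi_supported s : D0 s -> ~ `[alpha, beta]%classic s ->
  v s * inv_derive1 w s = 0.
Proof.
rewrite /D0 /= !in_itv/= andbT => s0 sab; rewrite psi0 ?mulr0//.
have [sa|as_] := leP s alpha; [by left|right].
by rewrite leNgt; apply/negP => sb; apply: sab; rewrite !ltW.
Qed.

Let theta_supported t : D0 t -> ~ `[beta^-1, alpha^-1]%classic t ->
  u t * mulX_derive2 w t = 0.
Proof.
rewrite /D0 /= !in_itv/= andbT => t0 tab; have tab' : ~ (a <= t <= b).
  move=> /andP[at_ tb]; apply: tab.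
  by rewrite (le_trans (ltW inv_beta))//= (le_trans tb) ?ltW//; case: inv_alpha.
by rewrite /mulX_derive2 w10// w20// !mulr0 addr0 mulr0.
Qed.

Let sub_ab : `[alpha, beta] `<=` D0.
Proof. by move=> s; rewrite /D0 /= !in_itv/= andbT; exact: pos. Qed.

Let sub_ba : `[beta^-1, alpha^-1] `<=` D0.
Proof.
move=> t; rewrite /D0 /= !in_itv/= andbT => /andP[bt _].
by apply: lt_le_trans bt; rewrite invr_gt0.
Qed.

Let ctheta : {within `[beta^-1, alpha^-1], continuous (fun t => u t * mulX_derive2 w t)}.
Proof.
apply: continuous_in_subspaceT => t; rewrite inE => /sub_ba t0.
by apply: cvgM; [exact: cu|exact: mulX_derive2_continuous].
Qed.

(** The coordinate form of the second equality: the right-hand side pairs [w]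
    with [t * dtt u], the left-hand side pairs [s |-> w (1/s)] with the
    derivative of [v]. *)
Lemma kelvin_pairing :
  [/\ mu.-integrable D0 (EFin \o (fun s => v s * derive1 (fun s => w s^-1) s)),
      mu.-integrable D0
        (EFin \o (fun t => u t * derive1 (derive1 (fun t => t * w t)) t)) &
      - (\int[mu]_(s in D0) (v s * derive1 (fun s => w s^-1) s)) =
      \int[mu]_(t in D0) (u t * derive1 (derive1 (fun t => t * w t)) t)].
Proof.
have [iv parts] := kelvin_integration_by_parts.
have W1 : {in D0, (fun s => v s * inv_derive1 w s) =1
    (fun s => v s * derive1 (fun s => w s^-1) s)}.
  move=> s; rewrite inE/D0 /= in_itv/= andbT => s0.
  by rewrite derive1E; have [_ ->] := is_derive_inv_var dw (lt0r_neq0 s0).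
have mD0 : measurable D0 by exact: measurable_itv.
rewrite mulX_derive2E//; split.
- have iv' : mu.-integrable D0 (EFin \o (fun s => v s * inv_derive1 w s)).
    exact: (integrable_supported _ _ sub_ab psi_supported iv).
  by apply: eq_integrable iv' => // s sD; rewrite /= W1.
- apply: (integrable_supported _ _ sub_ba theta_supported) => //.
  by apply: continuous_compact_integrable; [exact: segment_compact|exact: ctheta].
have -> : \int[mu]_(s in D0) (v s * derive1 (fun s => w s^-1) s) =
    \int[mu]_(s in D0) (v s * inv_derive1 w s).
  by apply: eq_Rintegral => s sD; rewrite -W1.
rewrite (Rintegral_supported (h := fun s => v s * inv_derive1 w s) sub_ab)//.
rewrite parts kelvin_substitution.
exact/esym/(Rintegral_supported (h := fun t => u t * mulX_derive2 w t) sub_ba).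
Qed.

End kelvin_by_parts.

(** * Equality of the spectral representations *)

Lemma Rintegral_sum d (T : measurableType d) (R : realType)
    (mu : {measure set T -> \bar R}) (n : nat) (D : set T) (h : 'I_n -> T -> R) :
  measurable D -> (forall i, mu.-integrable D (EFin \o h i)) ->
  \int[mu]_(x in D) (\sum_(i < n) h i x) = \sum_(i < n) \int[mu]_(x in D) h i x.
Proof.
move=> mD ih; rewrite sum_fine => [|i _]; last first.
  by apply: integrable_fin_num => //; exact: ih.
congr fine; rewrite -integral_sum//.
by apply: eq_integral => x _; rewrite sumEFin.
Qed.

Lemma phiVM_eq (R : realType) (n : nat) (u u' : R -> 'cV[R]_n) :
  (forall t, 0 < t -> u t = u' t) -> phiVM u = phiVM u'.
Proof.
move=> uu'; suff E : distr_of u = distr_of u' by rewrite /phiVM E.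
apply/funext => w; apply: eq_Rintegral => t; rewrite inE/= in_itv/= andbT => t0.
by rewrite uu'.
Qed.

Section spectral_representation.
Context (R : realType) (m n : nat) (K : 'M[R]_(m, n)) (f : 'cV[R]_n).
Context (u p v q : R -> 'cV[R]_n).
Hypothesis hK : diag_dominant (K *m K^T).
Hypothesis hu : gradient_flow (l1_analysis K) f u p.
Hypothesis hv : inverse_scale_space_flow (l1_analysis K) f v q.
Notation mu := (@lebesgue_measure R).

(** [kelvin s = s *: f - q s], and [q] has velocity [f - v] almost everywhere.
    *)
Lemma is_derive_kelvin i : {ae mu, forall s : R, 0 < s ->
  is_derive s (1 : R) (fun s => s * coordf u i s^-1) (coordf v i s)}.
Proof.
case: hv => _ _ _; apply: filterS; first exact: (ae_filter_ringOfSetsType mu).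
move=> s hs s0; have [qs _] := hs s0.
have D := is_deriveB (is_deriveM (is_derive_id s (1 : R)) (is_derive_cst (f i 0) s 1)) (qs i).
have near_eq : {near s, (fun x => x * f i 0 - coordf q i x) =1
    (fun s => s * coordf u i s^-1)}.
  apply: filterS (lt_nbhsr s0) => x x0.
  by rewrite /coordf (inverse_scale_space_dual_flow hK hu hv x0) !mxE; ring.
apply: DeriveDef.
  by apply: near_eq_derivable near_eq _; case: D.
rewrite -(near_eq_derive _ near_eq); have [_ Dv] := D; apply: (etrans Dv).
by rewrite /coordf /GRing.scale/= !mxE; ring.
Qed.

Lemma phiVM_phiIS : eq_distr (phiVM u) (phiIS v).
Proof.
move=> w [dw [a [b [a0 w0]]]].
have cu i : {in `]0, +oo[, continuous (coordf u i)}.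
  by case: hu => /(_ i)[/continuous_within_itvcyP[]].
have lip i c : 0 < c -> exists2 C : R, 0 < C & forall s s' : R, c <= s -> s <= s' ->
    `|s' * coordf u i s'^-1 - s * coordf u i s^-1| <= C * (s' - s).
  move=> c0; have [C C0 lip] := kelvin_lipschitz hK hu i c0.
  by exists C => // s s' cs ss'; have := lip s s' cs ss'; rewrite !mxE.
have mv i : measurable_fun (`]0, +oo[ : set R) (coordf v i) by case: hv.
have wi0 i t : ~ (a <= t <= b) -> coordf w i t = 0.
  by move=> /w0; rewrite /coordf => ->; rewrite mxE.
have pairing i := kelvin_pairing (dw i) a0 (wi0 i) (cu i) (mv i) (lip i)
  (is_derive_kelvin i).
have mD : measurable (`]0, +oo[ : set R) by exact: measurable_itv.
rewrite /phiVM /phiIS /phiIS_freq /distr_mulX /distr_inv_var /distr_derive opprK.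
rewrite /distr_of.
transitivity (\sum_(i < n) \int[mu]_(t in `]0, +oo[) (coordf u i t *
    derive1 (derive1 (fun t => t * coordf w i t)) t)).
  rewrite -Rintegral_sum// => [|i]; last by case: (pairing i).
  apply: eq_Rintegral => t _; apply: eq_bigr => i _; rewrite mxE; congr (_ * _).
  congr (derive1 _ t); apply/funext => s; rewrite /coordf mxE.
  by congr (derive1 _ s); apply/funext => r; rewrite /coordf mxE.
transitivity (\sum_(i < n) - (\int[mu]_(s in `]0, +oo[) (coordf v i s *
    derive1 (fun s => coordf w i s^-1) s))).
  by apply: eq_bigr => i _; have [_ _ ->] := pairing i.
rewrite sumrN -Rintegral_sum// => [|i]; last by case: (pairing i).
congr (- _); apply: eq_Rintegral => s _; apply: eq_bigr => i _.
by rewrite mxE.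
Qed.

End spectral_representation.

Theorem mainTheorem11 (R : realType) (m n : nat) (K : 'M[R]_(m, n))
    (f : 'cV[R]_n)
    (uGF pGF uVM vIS qIS : R -> 'cV[R]_n)
    (hK : diag_dominant (K *m K^T))
    (hGF : gradient_flow (l1_analysis K) f uGF pGF)
    (hVM : variational_method (l1_analysis K) f uVM)
    (hIS : inverse_scale_space_flow (l1_analysis K) f vIS qIS) :
  eq_distr (phiGF uGF) (phiVM uVM) /\ eq_distr (phiVM uVM) (phiIS vIS).
Proof.
have E : phiVM uVM = phiVM uGF.
  apply: phiVM_eq => t t0.
  apply: (variational_minimizer_unique t0 _ (hVM t t0 _)).
  exact: (gradient_flow_subdifferential hK hGF t0).
by rewrite E; split=> //; exact: (phiVM_phiIS hK hGF hIS).
Qed.
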